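(* Let $E$ be an infinite-dimensional (real or complex) Banach space which is saturated with subsymmetric sequences, i.e. every infinite-dimensional closed subspace of $E$ contains a subsymmetric sequence. Then $E$ contains an infinite-dimensional closed subspace which is minimal.
   Context: Two sequences $\{x_n\}_{n\in\mathbb N}$, $\{y_n\}_{n\in\mathbb N}$ of vectors of a Banach space are $c$-equivalent, for $c\geq 1$, if the mapping $T:\operatorname{span}\{x_n\}_n\to\operatorname{span}\{y_n\}_n$, $T(\sum_{i=1}^n a_i x_i)=\sum_{i=1}^n a_i y_i$, satisfies $\frac1c\|x\|\leq\|Tx\|\leq c\|x\|$ for all $x\in\operatorname{span}\{x_n\}_n$. A basic sequence $\{x_n\}_{n\in\mathbb N}$ in a Banach space is $c$-subsymmetric, for $c\geq 1$, if it is unconditional and is $c$-equivalent to each of its subsequences. It is subsymmetric if it is $c$-subsymmetric for some $c\geq 1$. A Banach space $F$ is minimal if every infinite-dimensional closed subspace of $F$ contains a further closed subspace which is isomorphic (linearly homeomorphic) to $F$. *)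

(* Defs.v *)
From HB Require Import structures.
From mathcomp Require Import all_boot all_order all_algebra.
From mathcomp Require Import all_classical all_reals.
From mathcomp Require Import topology normedtype sequences.
From mathcomp Require Export complex.

Set Implicit Arguments.
Unset Strict Implicit.
Unset Printing Implicit Defensive.

Import Order.TTheory GRing.Theory Num.Theory.
Import numFieldNormedType.Exports.

Local Open Scope classical_set_scope.
Local Open Scope ring_scope.

(* The scalar field K is kept generic; real and complex spaces are obtained
   for K := R and K := R[i] with R a realType. When K := R[i] the norm takes
   its values in R[i], and an inequality 1 <= c forces c to be real. *)

Section Spans.
Context {K : numFieldType} {E : normedModType K}.

Definition lspan (A : set E) : set E :=
  [set v | exists n (u : 'I_n -> E) (a : 'I_n -> K),
      (forall i, A (u i)) /\ v = \sum_(i < n) a i *: u i].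

Definition closed_span (A : set E) : set E := closure (lspan A).

Definition infinite_dimensional (F : set E) : Prop :=
  ~ exists s : seq E, F `<=` lspan [set` s].

Definition closed_subspace (F : set E) : Prop :=
  GRing.submod_closed [in F] /\ closed F.

End Spans.

Section Sequences.
Context {K : numFieldType} {E : normedModType K}.

(* A basic sequence is a Schauder basis of its closed linear span. *)
Definition basic_sequence (x : nat -> E) : Prop :=
  forall v, closed_span (range x) v ->
    exists! a : nat -> K, series (fun n => a n *: x n) @ \oo --> v.

Definition unconditionally_convergent (u : nat -> E) : Prop :=
  forall s : nat -> nat, bijective s -> cvgn (series (u \o s)).

Definition unconditional_basic_sequence (x : nat -> E) : Prop :=
  basic_sequence x /\
  forall v (a : nat -> K), closed_span (range x) v ->
    series (fun n => a n *: x n) @ \oo --> v ->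
    unconditionally_convergent (fun n => a n *: x n).

(* T is a total function on E, but only its values on the span of x matter. *)
Definition equivalent_sequences (c : K) (x y : nat -> E) : Prop :=
  exists T : E -> E,
    (forall n (a : nat -> K),
        T (\sum_(i < n) a i *: x i) = \sum_(i < n) a i *: y i) /\
    (forall v, lspan (range x) v -> c^-1 * `|v| <= `|T v| <= c * `|v|).

Definition c_subsymmetric (c : K) (x : nat -> E) : Prop :=
  unconditional_basic_sequence x /\
  forall phi : nat -> nat, increasing_seq phi ->
    equivalent_sequences c x (x \o phi).

Definition subsymmetric (x : nat -> E) : Prop :=
  exists c : K, 1 <= c /\ c_subsymmetric c x.

End Sequences.

Section Minimality.
Context {K : numFieldType} {E : normedModType K}.

(* Linear homeomorphism between two subspaces F and G of E, each with the
   topology induced by E; f and g are relevant only on F and G respectively. *)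
Definition isomorphic_subspaces (F G : set E) : Prop :=
  exists f g : E -> E,
    [/\ {in F &, forall u v, forall a : K, f (a *: u + v) = a *: f u + f v},
        set_bij F G f,
        {in F, cancel f g},
        {within F, continuous f} &
        {within G, continuous g}].

(* Applied to closed subspaces of a Banach space, which are themselves the
   Banach spaces whose minimality is asserted. *)
Definition minimal_space (F : set E) : Prop :=
  forall G : set E, closed_subspace G -> infinite_dimensional G -> G `<=` F ->
    exists H : set E,
      [/\ closed_subspace H, H `<=` G & isomorphic_subspaces H F].

Definition saturated_with_subsymmetric (F : set E) : Prop :=
  forall G : set E, closed_subspace G -> infinite_dimensional G -> G `<=` F ->
    exists x : nat -> E, range x `<=` G /\ subsymmetric x.

End Minimality.

(* Main.v *)
(**
  Formal vectors are finite combinations, with coefficients in a countable dense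
  subring of the scalars, of a subsymmetric sequence of E; a big set is a
  submodule of formal vectors that meets every tail.  For a constant C consider
  the game in which the first player builds a sequence (w_i) and the opponent a
  sequence (z_i): each w_i is chosen in a big set picked by the opponent, and
  each z_i in a tail picked by the first player, who wins if the two sequences
  are not C-equivalent.  As there are countably many positions, a diagonal
  argument yields a big set X in which every position is decided.
  - If the first player wins for every C, take a spreading sequence x in X: the
    opponent confines the w_i to the span of a tail of x and answers with shifts
    along x, so that the two sequences are C-equivalent for a C that does not
    depend on the play, a contradiction.
  - If the first player loses for some C, the restrictions can be exchanged:
    for all w_i in suitable tails of X and all big subsets Z of X, the answers
    z_i can be found in Z.  Take a spreading sequence x in X and a subspace G of
    its closed span: letting the w_i run through terms of x and Z approximate G
    yields a sequence in G equivalent to x, so the closed span of x is minimal.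
*)
From HB Require Import structures.
Require Import Defs.
From mathcomp Require Import all_boot all_order all_algebra.
From mathcomp Require Import all_classical all_reals.
From mathcomp Require Import topology normedtype sequences.
From mathcomp Require Import lra zify.
Import numFieldNormedType.Exports.
Local Open Scope classical_set_scope.
Local Open Scope ring_scope.
Local Open Scope complex_scope.

Set Implicit Arguments.
Unset Strict Implicit.
Unset Printing Implicit Defensive.

Import Order.TTheory GRing.Theory Num.Theory.

Lemma dependent_choice (S : Type) (r : S -> S -> Prop) (s0 : S) :
  (forall s, exists s', r s s') ->
  exists f : nat -> S, f 0%N = s0 /\ forall n, r (f n) (f n.+1).
Proof.
by move=> /choice[g rg]; exists (fun n => iter n g s0); split => // n; exact: rg.
Qed.

(** * An asymptotic game *)

Section Game.
Context {V : eqType} (T : nat -> set V) (Big : set (set V)) (W : set V)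
  (enum : nat -> seq V) (Open : set (seq V)).
Hypothesis T_decr : forall m n, (m <= n)%N -> T n `<=` T m.
Hypothesis Big_sub : forall Y, Big Y -> Y `<=` W.
Hypothesis Big_tail : forall Y n, Big Y -> Big (Y `&` T n).
Hypothesis Big_diag : forall Y : nat -> set V, (forall n, Big (Y n)) ->
  (forall n, Y n.+1 `<=` Y n) ->
  exists X, [/\ Big X, X `<=` Y 0%N & forall n, exists m, X `&` T m `<=` Y n].
Hypothesis enumP : forall p : seq V, (forall v, v \in p -> W v) -> exists n, enum n = p.

(* The positions from which the first player forces [Open]: the least solution
   of the three rules.  At even positions the opponent picks a big set [Y'] and
   the first player answers in it; at odd positions the first player picks a
   tail and the opponent answers in it. *)
Definition good (Y : set V) (p : seq V) : Prop :=
  forall P : set (seq V),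
    (forall q, Open q -> P q) ->
    (forall q, ~~ odd (size q) ->
       (forall Y', Big Y' -> Y' `<=` Y -> exists w, Y' w /\ P (rcons q w)) -> P q) ->
    (forall q, odd (size q) ->
       (exists n, forall z, (Y `&` T n) z -> P (rcons q z)) -> P q) ->
    P p.

Lemma good_open Y p : Open p -> good Y p.
Proof. by move=> Op P PO _ _; exact: PO. Qed.

Lemma good_even Y p : ~~ odd (size p) ->
  (forall Y', Big Y' -> Y' `<=` Y -> exists w, Y' w /\ good Y (rcons p w)) ->
  good Y p.
Proof.
move=> ep h P PO Pe Po; apply: (Pe) => // Y' bY' Y'Y.
have [w [Y'w gw]] := h _ bY' Y'Y.
by exists w; split => //; exact: gw.
Qed.

Lemma good_odd Y p : odd (size p) ->
  (exists n, forall z, (Y `&` T n) z -> good Y (rcons p z)) -> good Y p.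
Proof.
move=> op [n h] P PO Pe Po; apply: (Po) => //; exists n => z Yz.
exact: (h z Yz).
Qed.

(** The predicate [good Y'] is closed under the three rules for [Y]: a big set offered by the
    opponent is first cut to [T m], and a tail named by the first player is raised to at least
    [m]. *)
Lemma good_almost Y Y' m p : Y' `&` T m `<=` Y -> good Y p -> good Y' p.
Proof.
move=> Y'Y; apply.
- exact: good_open.
- move=> q eq h; apply: good_even => // Z bZ ZY'.
  have [|w [[Zw _] gw]] := h (Z `&` T m) (Big_tail m bZ).
    by move=> v [Zv Tv]; apply: Y'Y; split => //; exact: ZY'.
  by exists w.
- move=> q oq [n h]; apply: good_odd => //; exists (maxn m n) => z [Y'z Tz].
  apply: h; split; last by apply: T_decr Tz; exact: leq_maxr.
  by apply: Y'Y; split => //; apply: T_decr Tz; exact: leq_maxl.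
Qed.

(** Requirement [n] is met inside the set obtained for the earlier ones, and [Big_diag] yields a set
    almost contained in all of these. *)
Lemma stabilize (Q : nat -> set V -> Prop) Y0 : Big Y0 ->
  (forall n Y, Big Y -> Y `<=` Y0 -> exists Z, [/\ Big Z, Z `<=` Y & Q n Z]) ->
  exists X, [/\ Big X, X `<=` Y0 &
    forall n, exists Z m, [/\ Big Z, Q n Z & X `&` T m `<=` Z]].
Proof.
move=> bY0 h.
pose S := {Y : set V | Big Y /\ Y `<=` Y0}.
have [f [f0 fS]] := @dependent_choice (nat * S)
  (fun s t => [/\ t.1 = s.1.+1, sval t.2 `<=` sval s.2 & Q s.1 (sval t.2)])
  (0%N, exist _ Y0 (conj bY0 (fun _ h => h)))
  (fun s => ltac:(
    case: s => n [Y [bY YY0]];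
    have [Z [bZ ZY QZ]] := h n Y bY YY0;
    exists (n.+1, exist _ Z (conj bZ (subset_trans ZY YY0))); by [])).
have f1 n : (f n).1 = n.
  by elim: n => [|n IH]; [rewrite f0|have [-> _ _] := fS n; rewrite IH].
have [||X [bX X0 Xn]] := @Big_diag (fun n => sval (f n).2).
- by move=> n; case: (f n) => ? [? []].
- by move=> n; have [] := fS n.
exists X; split => //; first by move=> v /X0; rewrite f0.
move=> n; have [m Xm] := Xn n.+1; exists (sval (f n.+1).2), m; split => //.
  by case: (f n.+1) => ? [? []].
by have [_ _] := fS n; rewrite f1.
Qed.

(** Two diagonalizations: the first makes every position either good or bad for all big subsets, the
    second lets bad even positions stay bad under all moves far enough out. [B] consists of the bad
    positions with entries in [W]. *)
Theorem game_dichotomy Y0 : Big Y0 ->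
  (forall Z, Big Z -> Z `<=` Y0 -> ~ good Z [::]) ->
  exists (X : set V) (B : set (seq V)),
    [/\ Big X, X `<=` Y0 & B [::]] /\
    [/\ forall p, B p -> ~ Open p,
        forall p, B p -> ~~ odd (size p) ->
          exists n, forall w, (X `&` T n) w -> B (rcons p w) &
        forall p, B p -> odd (size p) -> forall Z, Big Z -> Z `<=` X ->
          exists z, Z z /\ B (rcons p z)].
Proof.
move=> bY0 nG.
pose HB Y p := forall Z, Big Z -> Z `<=` Y -> ~ good Z p.
have [X [bX XY0 Xdec]] : exists X, [/\ Big X, X `<=` Y0 &
    forall p : seq V, (forall v, v \in p -> W v) -> good X p \/ HB X p].
  have [|X [bX XY0 h]] := @stabilize
      (fun n Z => good Z (enum n) \/ HB Z (enum n)) Y0 bY0.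
    move=> n Y bY _.
    have [[Z [bZ ZY gZ]]|h] := pselect (exists Z, [/\ Big Z, Z `<=` Y & good Z (enum n)]).
      by exists Z; split => //; left.
    by exists Y; split => //; right => Z bZ ZY gZ; apply: h; exists Z.
  exists X; split => // p /enumP[n <-].
  have [Z [m [bZ [gZ|hZ] XZ]]] := h n; first by left; exact: (good_almost XZ gZ).
  right => Z' bZ' Z'X gZ'; apply: (hZ _ (Big_tail m bZ')) => [v [Z'v Tv]|].
    by apply: XZ; split => //; exact: Z'X.
  by apply: (@good_almost Z' _ 0%N) gZ' => v [[]].
have [|X' [bX' X'X hX']] := @stabilize
    (fun n Z => let p := enum n in (forall v, v \in p -> W v) -> HB X p ->
       ~~ odd (size p) -> forall w, Z w -> HB X (rcons p w)) X bX.
  move=> n Y bY YX /=.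
  have [[Wp [hp ep]]|h] := pselect ((forall v, v \in enum n -> W v) /\
      HB X (enum n) /\ ~~ odd (size (enum n))); last first.
    by exists Y; split => // Wp hp ep; exfalso; apply: h.
  (* If there were no such [Y'], the first player could reach a good position inside every big
     subset of [Y], and the present position would be good for [Y]. *)
  have [Y' [bY' Y'Y h]] : exists Y', [/\ Big Y', Y' `<=` Y &
      forall w, Y' w -> HB X (rcons (enum n) w)].
    apply: contrapT => nY.
    apply: (hp Y bY) => //; apply: good_even => // Y' bY' Y'Y.
    apply: contrapT => nw; apply: nY; exists Y'; split => // w Y'w.
    have [|g|//] := Xdec (rcons (enum n) w).
      move=> v; rewrite mem_rcons inE => /orP[/eqP->|/Wp//].
      exact: (Big_sub bY').
    exfalso; apply: nw; exists w; split => //.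
    by apply: (@good_almost X _ 0%N) g => v [/YX].
  by exists Y'; split => // _ _ _ w /h.
exists X', [set p : seq V | (forall v, v \in p -> W v) /\ HB X p].
split; split => //.
- by move=> v /X'X/XY0.
- by split => // Z bZ ZX; apply: nG => // v /ZX/XY0.
- by move=> p [_ hp] Op; apply: (hp X bX) => //; exact: good_open.
- move=> p [Wp hp] ep; have [n en] := enumP Wp.
  have [Z [m [bZ + X'Z]]] := hX' n; rewrite en => /(_ Wp hp ep) hZ.
  exists m => w X'w; split; last by apply: hZ; exact: X'Z.
  move=> v; rewrite mem_rcons inE => /orP[/eqP->|/Wp//].
  by apply: (Big_sub bX'); case: X'w.
- move=> p [Wp hp] op Z bZ ZX'; apply: contrapT => nz.
  apply: (hp Z bZ) => [v /ZX'/X'X//|].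
  (* If every answer in [Z] led to a good position, the first player would succeed by naming any
     tail, here [T 0]. *)
  apply: good_odd => //; exists 0%N => z [Zz _].
  have [|g|h] := Xdec (rcons p z).
  + move=> v; rewrite mem_rcons inE => /orP[/eqP->|/Wp//].
    exact: (Big_sub bZ).
  + by apply: (@good_almost X _ 0%N) g => v [/ZX'/X'X].
  + exfalso; apply: nz; exists z; split => //; split => //.
    move=> v; rewrite mem_rcons inE => /orP[/eqP->|/Wp//].
    exact: (Big_sub bZ).
Qed.

End Game.

(** * Formal vectors and big sets *)

Section LinearCombinations.
Context {K : fieldType}.

(* The coefficients of a combination are encoded as a polynomial. *)
Definition lc {W : lmodType K} (x : nat -> W) (q : {poly K}) : W :=
  \sum_(i < size q) q`_i *: x i.

Lemma lc_widen {W : lmodType K} (x : nat -> W) (q : {poly K}) n : (size q <= n)%N ->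
  lc x q = \sum_(i < n) q`_i *: x i.
Proof.
move=> qn; rewrite /lc (big_ord_widen n (fun i => q`_i *: x i)) //.
rewrite big_mkcond; apply: eq_bigr => i _; case: ltnP => // /(nth_default 0) ->.
by rewrite scale0r.
Qed.

Lemma lc_linear {W : lmodType K} (x : nat -> W) : linear (lc x).
Proof.
move=> a p q; set n := maxn (size p) (size q).
have pn : (size p <= n)%N by rewrite leq_maxl.
have qn : (size q <= n)%N by rewrite leq_maxr.
have apn : (size (a *: p + q)%R <= n)%N.
  rewrite (leq_trans (size_polyD _ _)) // geq_max qn andbT.
  by rewrite (leq_trans (size_scale_leq _ _)).
rewrite (lc_widen x pn) (lc_widen x qn) (lc_widen x apn).
rewrite scaler_sumr -big_split; apply: eq_bigr => i _ /=.
by rewrite coefD coefZ scalerDl scalerA.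
Qed.

HB.instance Definition _ (W : lmodType K) (x : nat -> W) :=
  GRing.isLinear.Build K {poly K} W *:%R (lc x) (lc_linear x).

Lemma lcX {W : lmodType K} (x : nat -> W) k : lc x 'X^k = x k.
Proof.
rewrite /lc size_polyXn (bigD1 ord_max) //= coefXn eqxx scale1r big1 ?addr0 // => i.
by rewrite coefXn -val_eqE /= => /negPf ->; rewrite scale0r.
Qed.

Lemma lc_poly {W : lmodType K} (x : nat -> W) n (a : nat -> K) :
  lc x (\poly_(i < n) a i) = \sum_(i < n) a i *: x i.
Proof.
rewrite (lc_widen x (size_poly n a)); apply: eq_bigr => i _.
by rewrite coef_poly ltn_ord.
Qed.

Lemma lc_lc {W : lmodType K} (x : nat -> W) (F : nat -> {poly K}) (q : {poly K}) :
  lc x (lc F q) = lc (fun i => lc x (F i)) q.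
Proof. by rewrite [lc F q]/lc linear_sum; apply: eq_bigr => i _; rewrite linearZ. Qed.

Lemma eq_lc {W : lmodType K} (x y : nat -> W) (q : {poly K}) :
  (forall i, (i < size q)%N -> x i = y i) -> lc x q = lc y q.
Proof. by move=> xy; apply: eq_bigr => i _; rewrite xy. Qed.

Lemma lc_comp {W : lmodType K} (x : nat -> W) (s : nat -> nat) (q : {poly K}) :
  lc (x \o s) q = lc x (lc (fun i => 'X^(s i)) q).
Proof. by rewrite lc_lc; apply: eq_lc => i _; rewrite lcX. Qed.

Lemma coef_lc (F : nat -> {poly K}) (q : {poly K}) k :
  (lc F q)`_k = \sum_(i < size q) q`_i * (F i)`_k.
Proof. by rewrite /lc coef_sum; apply: eq_bigr => i _; rewrite coefZ. Qed.

Definition tail (n : nat) : set {poly K} :=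
  [set p | forall i, (i < n)%N -> p`_i = 0].

Lemma tail_decr m n : (m <= n)%N -> tail n `<=` tail m.
Proof. by move=> mn p Tp i im; apply: Tp; exact: leq_trans mn. Qed.

Lemma tail_lc m n (F : nat -> {poly K}) (q : {poly K}) : tail m q ->
  (forall i, (m <= i)%N -> tail n (F i)) -> tail n (lc F q).
Proof.
move=> mq nF k kn; rewrite coef_lc big1 // => i _.
have [im|mi] := ltnP i m; first by rewrite mq ?mul0r.
by rewrite nF ?mulr0.
Qed.

Lemma tail_size n (p : {poly K}) : tail n p -> p != 0 -> (n < size p)%N.
Proof.
move=> np p0; rewrite ltnNge; apply: contra p0 => pn.
apply/eqP/polyP => i; rewrite coef0; have [/np//|ni] := ltnP i n.
by rewrite nth_default // (leq_trans pn).
Qed.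

Lemma tailXn n k : (n <= k)%N -> tail n 'X^k.
Proof. by move=> nk i im; rewrite coefXn ltn_eqF // (leq_trans im). Qed.

(** Block sequences of Banach space theory, [size] marking the end of a support. *)
Definition block (F : nat -> {poly K}) : Prop :=
  (forall i, F i != 0) /\ forall i j, (i < j)%N -> tail (size (F i)) (F j).

(** At the leading monomial of [F j] the earlier blocks have ended and the later ones have not
    begun. *)
Lemma block_coef F (q : {poly K}) j : block F ->
  (lc F q)`_(size (F j)).-1 = q`_j * lead_coef (F j).
Proof.
move=> [F0 bF].
have sF i k : (i < k)%N -> (size (F i) < size (F k))%N.
  by move=> /bF /tail_size -> //.
have jn : (j < maxn (size q) j.+1)%N by rewrite leq_max ltnSn orbT.
rewrite (@lc_widen _ F q (maxn (size q) j.+1)) ?leq_maxl //.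
rewrite coef_sum (bigD1 (Ordinal jn)) //= coefZ big1 ?addr0 // => i.
rewrite -val_eqE /= coefZ neq_ltn => /orP[ij|ji]; last first.
  rewrite (bF _ _ ji) ?mulr0 // prednK //.
  by rewrite lt0n size_poly_eq0.
rewrite (nth_default 0) ?mulr0 // -ltnS prednK; first exact: sF.
by rewrite lt0n size_poly_eq0.
Qed.

Lemma block_tail F j : block F -> tail j (F j).
Proof.
move=> [F0 bF].
case: j => [i //|j]; apply: tail_decr (bF j j.+1 (ltnSn j)).
elim: j => [|j IH]; first by rewrite lt0n size_poly_eq0.
by apply: leq_ltn_trans IH _; apply: tail_size => //; exact: bF.
Qed.

End LinearCombinations.

(** * Big sets over a countable coefficient ring *)

Section BigSets.
Context {K : fieldType} {D : countComNzRingType} (iota : {rmorphism D -> K}).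

Notation V := {poly K}.

Definition Dpoly : set V := range (map_poly iota).

Definition Dsubmod (Y : set V) : Prop :=
  Y 0 /\ forall d u v, Y u -> Y v -> Y (iota d *: u + v).

Definition Dspan (F : nat -> V) : set V := lc F @` Dpoly.

Definition big (Y : set V) : Prop :=
  [/\ Y `<=` Dpoly, Dsubmod Y & forall n, exists y, [/\ Y y, tail n y & y != 0]].

Lemma Dsubmod_Dpoly : Dsubmod Dpoly.
Proof.
split; first by exists 0 => //; rewrite rmorph0.
move=> d _ _ [p _ <-] [q _ <-]; exists (d *: p + q) => //.
by rewrite rmorphD /= map_polyZ.
Qed.

Lemma Dpoly_coef (p : V) i : Dpoly p -> exists d, p`_i = iota d.
Proof. by move=> [r _ <-]; exists r`_i; rewrite coef_map. Qed.

Lemma Dpoly_coefP (p : V) : (forall i, exists d, p`_i = iota d) -> Dpoly p.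
Proof.
move=> /choice[d pd]; exists (\poly_(i < size p) d i) => //.
apply/polyP => i; rewrite coef_map coef_poly pd; case: ltnP => // ip.
by rewrite -pd nth_default // raddf0.
Qed.

Lemma Dsubmod_lc Y F (p : V) : Dsubmod Y -> Dpoly p ->
  (forall i, p`_i != 0 -> Y (F i)) -> Y (lc F p).
Proof.
move=> [Y0 YD] Dp YF; rewrite /lc.
elim/big_ind: _ => [//|u v Yu Yv|i _].
  by rewrite -[u]scale1r -(rmorph1 iota); exact: YD.
have [->|/YF YFi] := eqVneq p`_i 0; first by rewrite scale0r.
have [d ->] := Dpoly_coef i Dp.
by rewrite -[_ *: _]addr0; exact: YD.
Qed.

Lemma Dspan_sub Y F : Dsubmod Y -> (forall i, Y (F i)) -> Dspan F `<=` Y.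
Proof. by move=> YD YF _ [p Dp <-]; exact: Dsubmod_lc. Qed.

Lemma Dpoly_Xn i : Dpoly 'X^i.
Proof. by exists 'X^i => //; rewrite map_polyXn. Qed.

Lemma big_Dspan F : (forall i, Dpoly (F i)) ->
  (forall n, exists i, tail n (F i) /\ F i != 0) -> big (Dspan F).
Proof.
move=> DF nF; split.
- exact: Dspan_sub Dsubmod_Dpoly DF.
- split; first by exists 0; [exact: Dsubmod_Dpoly.1|rewrite linear0].
  move=> d _ _ [p Dp <-] [q Dq <-]; exists (iota d *: p + q).
    exact: Dsubmod_Dpoly.2.
  by rewrite linearP.
- move=> n; have [i [nFi Fi0]] := nF n; exists (F i); split => //.
  by exists 'X^i; [exact: Dpoly_Xn|rewrite lcX].
Qed.

Lemma big_Dpoly : big Dpoly.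
Proof.
split => //; first exact: Dsubmod_Dpoly.
move=> n; exists 'X^n; split; [exact: Dpoly_Xn|exact: tailXn|].
by rewrite monic_neq0 // monicXn.
Qed.

Lemma big_subset Y : big Y -> Y `<=` Dpoly. Proof. by case. Qed.

Lemma big_tail Y n : big Y -> big (Y `&` tail n).
Proof.
move=> [YD [Y0 Ysub] Ybig]; split.
- by move=> p [/YD].
- split; first by split => // i _; rewrite coef0.
  move=> d u v [Yu Tu] [Yv Tv]; split; first exact: Ysub.
  by move=> i im; rewrite coefD coefZ Tu // Tv // mulr0 addr0.
- move=> m; have [y [Yy Ty y0]] := Ybig (maxn m n).
  exists y; split => //; last by apply: tail_decr Ty; exact: leq_maxl.
  by split => //; apply: tail_decr Ty; exact: leq_maxr.
Qed.

Lemma big_block (Y : nat -> set V) : (forall n, big (Y n)) ->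
  exists F, block F /\ forall n, Y n (F n).
Proof.
move=> bY.
have [y0 [Yy0 _ y00]] : exists y, [/\ Y 0%N y, tail 0 y & y != 0] by case: (bY 0%N).
have [f [f0 fS]] := @dependent_choice {s : nat * V | Y s.1 s.2 /\ s.2 != 0}
  (fun s t => (sval t).1 = (sval s).1.+1 /\ tail (size (sval s).2) (sval t).2)
  (exist _ (0%N, y0) (conj Yy0 y00))
  (fun s => ltac:(
    case: s => -[n y] [/= Yy yn0];
    have [_ _ /(_ (size y))[z [Yz Tz zn0]]] := bY n.+1;
    exists (exist _ (n.+1, z) (conj Yz zn0)); by [])).
have f1 n : (sval (f n)).1 = n.
  by elim: n => [|n IH]; [rewrite f0|have [-> _] := fS n; rewrite IH].
exists (fun n => (sval (f n)).2); split; last first.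
  by move=> n; case: (f n) (f1 n) => -[m y] /= [Yy _] <-.
have n0 i : (sval (f i)).2 != 0 by case: (f i) => -[m y] /= [].
split => // i j; elim: j => // j IH; rewrite ltnS leq_eqVlt => /orP[/eqP ->|].
  by case: (fS j).
move=> /IH Tij; apply: tail_decr (fS j).2.
by apply: ltnW; exact: tail_size.
Qed.

Lemma big_Dspan_block F : (forall i, Dpoly (F i)) -> block F -> big (Dspan F).
Proof.
move=> DF bF; apply: big_Dspan => // n; exists n; split; last by case: bF.
exact: block_tail.
Qed.

Lemma decr_set (Y : nat -> set V) : (forall n, Y n.+1 `<=` Y n) ->
  forall m n, (m <= n)%N -> Y n `<=` Y m.
Proof.
move=> YS m n /subnK <-; elim: (n - m)%N => [//|k IH].
by rewrite addSn => v /YS /IH.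
Qed.

(** The set is the [D]-span of a block sequence with [F n] in [Y n]. A vector of it starting beyond
    [F n] has zero coefficients before index [n], as read off at leading monomials, and the
    remaining blocks lie in [Y n]. *)
Lemma big_diag (Y : nat -> set V) : (forall n, big (Y n)) ->
  (forall n, Y n.+1 `<=` Y n) ->
  exists X, [/\ big X, X `<=` Y 0%N & forall n, exists m, X `&` tail m `<=` Y n].
Proof.
move=> bY /decr_set Yd; have [F [bF YF]] := big_block bY.
exists (Dspan F); split.
- by apply: big_Dspan_block => // i; case: (bY i) => + _ _; apply.
- apply: Dspan_sub; first by case: (bY 0%N).
  by move=> i; exact: Yd (YF i).
- move=> n; exists (size (F n)) => _ [[p Dp <-] Tp].
  apply: Dsubmod_lc => //; first by case: (bY n).
  move=> i pi0; apply: Yd (YF i); rewrite leqNgt; apply: contra pi0 => ilt.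
  have := Tp (size (F i)).-1; rewrite block_coef // => /(_ _)/eqP.
  rewrite mulf_eq0 lead_coef_eq0 (negPf (bF.1 i)) orbF; apply.
  have [F0 bF'] := bF.
  apply: leq_ltn_trans (leq_pred _) _; apply: tail_size => //; exact: bF'.
Qed.

(** Numbers that code nothing give the empty position; only surjectivity matters. *)
Definition Dpositions (n : nat) : seq V :=
  if @unpickle (seq {poly D}) n is Some s then map (map_poly iota) s else [::].

Lemma DpositionsP (p : seq V) :
  (forall v, v \in p -> Dpoly v) -> exists n, Dpositions n = p.
Proof.
move=> h.
have [s <-] : exists s : seq {poly D}, map (map_poly iota) s = p.
  elim: p h => [|v p IH] h; first by exists [::].
  have [|s <-] := IH; first by move=> w wp; apply: h; rewrite inE wp orbT.
  have [r _ rv] := h v (mem_head _ _).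
  by exists (r :: s); rewrite /= rv.
by exists (pickle s); rewrite /Dpositions pickleK.
Qed.

End BigSets.

(** * Spreading sequences *)

Lemma sum_halves {R : realFieldType} n :
  \sum_(k < n) (2^-1 : R) ^+ k.+2 <= 2^-1.
Proof.
suff -> : \sum_(k < n) (2^-1 : R) ^+ k.+2 = 2^-1 - 2^-1 ^+ n.+1.
  by rewrite lerBlDr lerDl exprn_ge0 // invr_ge0.
elim: n => [|n IH]; first by rewrite big_ord0 expr1 subrr.
by rewrite big_ord_recr /= IH !exprS; lra.
Qed.

(* [K] will be [R] or [R[i]], [rho] the embedding of the reals and [re] the real
   part. *)
Section Norm.
Context {R : realType} {K : numFieldType} (rho : {rmorphism R -> K}) (re : K -> R).
Hypothesis rho_le : {mono rho : x y / x <= y}.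
Hypothesis reK : forall k, k \is Num.real -> rho (re k) = k.

(* Norms with values in [R], so that real arithmetic applies also when the
   scalars are complex. *)
Definition nrm {W : normedZmodType K} (v : W) : R := re `|v|.

Lemma rho_lt : {mono rho : x y / x < y}.
Proof. exact: leW_mono. Qed.

Lemma nrmE {W : normedZmodType K} (v : W) : rho (nrm v) = `|v|.
Proof. by rewrite reK // normr_real. Qed.

Lemma nrm_ge0 {W : normedZmodType K} (v : W) : 0 <= nrm v.
Proof. by rewrite -rho_le rmorph0 nrmE. Qed.

Lemma nrm0 {W : normedZmodType K} : nrm (0 : W) = 0.
Proof. by apply: (fmorph_inj rho); rewrite nrmE normr0 rmorph0. Qed.

Lemma nrm_eq0 {W : normedZmodType K} (v : W) : (nrm v == 0) = (v == 0).
Proof. by rewrite -(fmorph_eq0 rho) nrmE normr_eq0. Qed.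

Lemma nrm_gt0 {W : normedZmodType K} (v : W) : (0 < nrm v) = (v != 0).
Proof. by rewrite lt_neqAle nrm_ge0 andbT eq_sym nrm_eq0. Qed.

Lemma nrmD {W : normedZmodType K} (u v : W) : nrm (u + v) <= nrm u + nrm v.
Proof. by rewrite -rho_le rmorphD !nrmE ler_normD. Qed.

Lemma nrmN {W : normedZmodType K} (v : W) : nrm (- v) = nrm v.
Proof. by rewrite /nrm normrN. Qed.

Lemma nrmBC {W : normedZmodType K} (u v : W) : nrm (u - v) = nrm (v - u).
Proof. by rewrite -nrmN opprB. Qed.

Lemma nrmB {W : normedZmodType K} (u v : W) : nrm (u - v) <= nrm u + nrm v.
Proof. by rewrite -(nrmN v) nrmD. Qed.

Lemma nrm_tri {W : normedZmodType K} (w u v : W) :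
  nrm (u - v) <= nrm (u - w) + nrm (w - v).
Proof. by apply: le_trans (nrmD _ _); rewrite addrA subrK. Qed.

Lemma nrm_sum {W : normedZmodType K} n (u : 'I_n -> W) :
  nrm (\sum_(i < n) u i) <= \sum_(i < n) nrm (u i).
Proof.
elim/big_rec2: _ => [|i a b _ ab]; first by rewrite nrm0.
by apply: le_trans (nrmD _ _) _; rewrite lerD2l.
Qed.

Lemma nrmM (a b : K) : nrm (a * b) = nrm a * nrm b.
Proof. by apply: (fmorph_inj rho); rewrite rmorphM !nrmE normrM. Qed.

Lemma nrm1 : nrm (1 : K) = 1.
Proof. by apply: (fmorph_inj rho); rewrite nrmE normr1 rmorph1. Qed.

Context {E : completeNormedModType K}.
Implicit Types (x y : nat -> E) (q : {poly K}).

Lemma nrmZ (a : K) (v : E) : nrm (a *: v) = nrm a * nrm v.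
Proof. by apply: (fmorph_inj rho); rewrite rmorphM !nrmE normrZ. Qed.

Definition equiv (C : R) x y : Prop :=
  forall q, nrm (lc x q) <= C * nrm (lc y q) /\ nrm (lc y q) <= C * nrm (lc x q).

Lemma equiv_sym C x y : equiv C x y -> equiv C y x.
Proof. by move=> xy q; have [? ?] := xy q. Qed.

Lemma equiv_trans C C' x y z : 0 <= C -> 0 <= C' ->
  equiv C x y -> equiv C' y z -> equiv (C * C') x z.
Proof.
move=> C0 C'0 xy yz q; have [a b] := xy q; have [c d] := yz q; split.
  by apply: le_trans a _; rewrite -mulrA ler_wpM2l.
by apply: le_trans d _; rewrite (mulrC C) -mulrA ler_wpM2l.
Qed.

Lemma equiv_lc C x y (F : nat -> {poly K}) :
  equiv C x y -> equiv C (lc x \o F) (lc y \o F).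
Proof. by move=> xy q; rewrite -!lc_lc. Qed.

Lemma equiv_le C C' x y : C <= C' -> equiv C x y -> equiv C' x y.
Proof.
move=> CC' xy q; have [a b] := xy q; split; apply: le_trans (ler_wpM2r _ CC').
- exact: a.
- exact: nrm_ge0.
- exact: b.
- exact: nrm_ge0.
Qed.

(** [M k] bounds the norm of the k-th coordinate functional on the span of [x]. *)
Definition coef_bound (M : nat -> R) x : Prop :=
  forall q k, nrm q`_k <= M k * nrm (lc x q).

Lemma coef_bound_gt0 M x k : coef_bound M x -> 0 < M k.
Proof.
move=> /(_ 'X^k k); rewrite coefXn eqxx nrm1 lcX => h.
have := nrm_ge0 (x k) => h0; rewrite ltNge; apply/negP => Mk; nra.
Qed.

Definition spreading (c : R) x : Prop :=
  forall phi : nat -> nat, {homo phi : m n / (m < n)%N} -> equiv c x (x \o phi).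

Lemma spreading_equiv C c x y : 0 <= C -> 0 <= c -> equiv C x y ->
  spreading c x -> spreading (C * c * C) y.
Proof.
move=> C0 c0 xy sx phi phiP.
have xyphi : equiv C (x \o phi) (y \o phi).
  by move=> q; rewrite (lc_comp x) (lc_comp y); exact: xy.
apply: (equiv_trans _ C0 _ xyphi); first exact: mulr_ge0.
by apply: (equiv_trans C0 c0 (equiv_sym xy)); exact: sx.
Qed.

Lemma coef_bound_equiv C M x y : equiv C x y ->
  coef_bound M x -> coef_bound (fun k => M k * C) y.
Proof.
move=> xy Mx q k; apply: le_trans (Mx q k) _; have M0 := coef_bound_gt0 k Mx.
by have [h _] := xy q; rewrite -mulrA; exact: ler_wpM2l (ltW M0) _ _ h.
Qed.

(* Two subsequences that differ only in their k-th term isolate the k-th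
   coefficient. *)
Lemma spreading_coef_bound c y : 0 <= c -> spreading c y -> y 0%N != y 1%N ->
  coef_bound (fun=> 2 * c ^+ 2 / nrm (y 0%N - y 1%N)) y.
Proof.
move=> c0 sy y01 q k.
(* [phi1] omits the value [k.+1] and [phi2] the value [k]. *)
pose phi1 i := if (i <= k)%N then i else i.+1.
pose phi2 i := if (i < k)%N then i else i.+1.
have [|_ h1] := sy phi1 _ q.
  by move=> m n mn; rewrite /phi1; do 2 case: ifP; lia.
have [|_ h2] := sy phi2 _ q.
  by move=> m n mn; rewrite /phi2; do 2 case: ifP; lia.
(* A shift carries [y 0 - y 1] to [y k - y k.+1], which bounds the latter from below uniformly in
   [k]. *)
have [|h3 _] := sy (addn k) _ (1 - 'X).
  by move=> m n; rewrite ltn_add2l.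
have e3 (z : nat -> E) : lc z (1 - 'X) = z 0%N - z 1%N.
  by rewrite linearB /= -['X]expr1 -[1 in LHS](expr0 'X) !lcX.
rewrite !e3 /= addn0 addn1 in h3.
have d12 : lc (y \o phi1) q - lc (y \o phi2) q = q`_k *: (y k - y k.+1).
  rewrite -[q in LHS]coefK !lc_poly -sumrB.
  have [qk|kq] := leqP (size q) k.
    rewrite nth_default // scale0r big1 // => i _.
    by rewrite /phi1 /phi2 /= ltnW ?(leq_trans (ltn_ord i)) // subrr.
  rewrite (bigD1 (Ordinal kq)) //= big1 ?addr0 => [|i].
    by rewrite /phi1 /phi2 leqnn ltnn -scalerBr.
  rewrite -val_eqE /= /phi1 /phi2 => ik.
  by rewrite ltn_neqAle ik /= subrr.
have : nrm q`_k * nrm (y k - y k.+1) <= 2 * c * nrm (lc y q).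
  rewrite -nrmZ -d12; apply: le_trans (nrmB _ _) _; lra.
have d0 : 0 < nrm (y 0%N - y 1%N) by rewrite nrm_gt0 subr_eq0.
move=> h4.
rewrite mulrAC ler_pdivlMr //.
have q0 := nrm_ge0 q`_k.
apply: (@le_trans _ _ (c * (nrm q`_k * nrm (y k - y k.+1)))).
  by rewrite mulrCA ler_wpM2l.
rewrite (_ : 2 * c ^+ 2 * _ = c * (2 * c * nrm (lc y q))); last by rewrite expr2; lra.
exact: ler_wpM2l.
Qed.

(** Small perturbation principle: the coefficient bound turns the summable errors into a relative
    error of at most one half. *)
Lemma equiv_perturb M d x : coef_bound (fun=> M) d ->
  (forall k, M * nrm (d k - x k) <= 2^-1 ^+ k.+2) -> equiv 2 d x.
Proof.
move=> Md dx q; have M0 := coef_bound_gt0 0 Md.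
have h : nrm (lc d q - lc x q) <= 2^-1 * nrm (lc d q).
  rewrite -[q in lc d q - _]coefK -[q in lc x q]coefK !lc_poly -sumrB.
  apply: le_trans (nrm_sum _) _.
  apply: (@le_trans _ _ (\sum_(k < size q) nrm (lc d q) * 2^-1 ^+ k.+2)).
    apply: ler_sum => k _; rewrite -scalerBr nrmZ.
    apply: (@le_trans _ _ (M * nrm (lc d q) * nrm (d k - x k))).
      by rewrite ler_wpM2r ?nrm_ge0.
    by rewrite mulrAC mulrC ler_wpM2l ?nrm_ge0.
  rewrite -mulr_sumr mulrC ler_wpM2r ?nrm_ge0 //; exact: sum_halves.
have h1 := nrmD (lc d q - lc x q) (lc x q); rewrite subrK in h1.
have h2 := nrmB (lc d q) (lc d q - lc x q); rewrite subKr in h2.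
split; lra.
Qed.

(** * Compactness of scalars and approximation by tail vectors *)

Hypothesis balls_precompact : forall B e : R, 0 < e ->
  exists s : seq K, forall a, nrm a <= B -> exists t, t \in s /\ nrm (a - t) < e.

Definition infinitely_many (S : set nat) : Prop := forall n, exists m, (n <= m)%N /\ S m.

(** Induction on [s]: if the piece of [t] is bounded, the rest of the list covers a final segment of
    [S], which is still infinite. *)
Lemma infinitely_many_cover (S : set nat) (s : seq K) (P : K -> set nat) :
  infinitely_many S -> (forall n, S n -> exists t, t \in s /\ P t n) ->
  exists t, infinitely_many (S `&` P t).
Proof.
elim: s S => [|t s IH] S iS Ss.
  by have [n [_ /Ss[t []]]] := iS 0%N.
have [h|h] := pselect (infinitely_many (S `&` P t)); first by exists t.
have [N hN] : exists N, forall m, (N <= m)%N -> S m -> ~ P t m.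
  apply: contrapT => nN; apply: h => n; apply: contrapT => nm.
  by apply: nN; exists n => m nm' Sm Pm; apply: nm; exists m.
have [||u iu] := IH (S `&` [set m | (N <= m)%N]).
- move=> n; have [m [nm Sm]] := iS (maxn n N); exists m.
  by move: nm; rewrite geq_max => /andP[-> /= ?]; split.
- move=> n [Sn Nn]; have [v [+ Pv]] := Ss n Sn; rewrite inE => /orP[/eqP vt|vs].
    by move: Pv; rewrite vt => /(hN _ Nn Sn).
  by exists v.
exists u => n; have [m [nm [[Sm _] Pm]]] := iu n; by exists m.
Qed.

(** One coordinate at a time: finitely many balls of radius [e / 2] cover its values, and one of
    them serves infinitely many indices. *)
Lemma pigeonhole (al : nat -> nat -> K) (B : nat -> R) (e : R) m :
  (forall n i, nrm (al n i) <= B i) -> 0 < e ->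
  exists S, infinitely_many S /\ forall n n' i, S n -> S n' -> (i < m)%N ->
    nrm (al n i - al n' i) < e.
Proof.
move=> alB e0; elim: m => [|m [S [iS hS]]].
  by exists setT; split => // n; exists n.
have [|s hs] := balls_precompact (B m) (e := e / 2); first by rewrite divr_gt0.
have [|t it] := @infinitely_many_cover S s (fun t n => nrm (al n m - t) < e / 2) iS.
  by move=> n _; exact: hs.
exists (S `&` (fun n => nrm (al n m - t) < e / 2)); split => //.
move=> n n' i [Sn Pn] [Sn' Pn']; rewrite ltnS leq_eqVlt => /orP[/eqP ->|]; last exact: hS.
apply: le_lt_trans (nrm_tri t _ _) _; rewrite (nrmBC t).
by rewrite (splitr e) ltrD.
Qed.

Context {D : countComNzRingType} (iota : {rmorphism D -> K}).
Hypothesis iota_dense : forall a (e : R), 0 < e -> exists d, nrm (a - iota d) < e.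

(** Vanishing coefficients are kept exactly, so approximants of tail vectors stay in the tail. *)
Lemma Dpoly_approx x (w : {poly K}) (e : R) : 0 < e ->
  exists b, [/\ Dpoly iota b, forall i, w`_i = 0 -> b`_i = 0 &
    nrm (lc x w - lc x b) < e].
Proof.
move=> e0; set n := size w.
(* The summand 1 keeps [B] positive and makes the final estimate strict. *)
pose B := 1 + \sum_(i < n) nrm (x i).
have B0 : 0 < B by rewrite ltr_wpDr // sumr_ge0 // => i _; exact: nrm_ge0.
have eB : 0 < e / B by rewrite divr_gt0.
have [d wd] : exists d : nat -> D, forall i, nrm (w`_i - iota (d i)) < e / B.
  suff /choice[d ?] : forall i, exists d, nrm (w`_i - iota d) < e / B by exists d.
  by move=> i; exact: iota_dense.
pose b : {poly K} := \poly_(i < n) (if w`_i == 0 then 0 else iota (d i)).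
exists b; split.
- apply: Dpoly_coefP => i; rewrite coef_poly.
  case: ifP => _; last by exists 0; rewrite rmorph0.
  by case: eqP => _; [exists 0; rewrite rmorph0|exists (d i)].
- by move=> i wi; rewrite coef_poly wi eqxx if_same.
- rewrite -[w in lc x w]coefK !lc_poly -sumrB.
  apply: le_lt_trans (nrm_sum _) _.
  apply: (@le_lt_trans _ _ (\sum_(i < n) e / B * nrm (x i))).
    apply: ler_sum => i _; rewrite -scalerBl nrmZ ler_wpM2r ?nrm_ge0 //.
    case: eqP => [->|_]; first by rewrite subrr nrm0 ltW.
    exact: ltW.
  rewrite -mulr_sumr -mulrA gtr_pMr // mulrC ltr_pdivrMr // mul1r.
  by rewrite /B ltrDr.
Qed.

Lemma split_tail (v : {poly K}) m :
  exists v', tail m v' /\ forall x,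
    nrm (lc x v - lc x v') <= \sum_(i < m) nrm v`_i * nrm (x i).
Proof.
exists (v - \poly_(i < m) v`_i); split.
  by move=> i im; rewrite coefB coef_poly im subrr.
move=> x; rewrite linearB /= subKr lc_poly.
apply: le_trans (nrm_sum _) _; apply: ler_sum => i _.
by rewrite nrmZ.
Qed.

(** Approximants of the [y n] have bounded coefficients, so two of them nearly agree on the first
    [m] places; their difference is cut to a tail vector, whose coefficients are then moved into the
    dense ring. *)
Lemma tail_difference M f y (B : R) : coef_bound M f ->
  (forall n, nrm (y n) <= B) ->
  (forall n (e : R), 0 < e -> exists q, nrm (y n - lc f q) < e) ->
  forall m n0 (e : R), 0 < e -> exists n n' b,
    [/\ (n0 <= n < n')%N, Dpoly iota b, tail m b & nrm (y n - y n' - lc f b) < e].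
Proof.
move=> Mf yB yf m n0 e e0.
(* Four errors arise: approximating [y n] and [y n'], dropping the first [m] coefficients, and
   passing to [b]. *)
have e4 : 0 < e / 4 by lra.
have [u yu] : exists u, forall n, nrm (y n - lc f (u n)) < e / 4.
  suff /choice[u ?] : forall n, exists q, nrm (y n - lc f q) < e / 4 by exists u.
  by move=> n; exact: yf.
pose F := 1 + \sum_(i < m) nrm (f i).
have F0 : 0 < F by rewrite ltr_wpDr // sumr_ge0 // => i _; exact: nrm_ge0.
have eF : 0 < e / 4 / F by rewrite divr_gt0.
have [|S [iS hS]] := @pigeonhole (fun n i => (u n)`_i) (fun i => M i * (B + e / 4))
    (e / 4 / F) m _ eF.
  move=> n i; apply: le_trans (Mf _ _) _.
  apply: ler_wpM2l; first exact: ltW (coef_bound_gt0 i Mf).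
  have := nrmB (y n) (y n - lc f (u n)); rewrite subKr => h.
  have := yu n; have := yB n; lra.
have [n [n0n Sn]] := iS n0; have [n' [nn' Sn']] := iS n.+1.
have [v [Tv hv]] := split_tail (u n - u n') m.
have [b [Db bv hb]] := @Dpoly_approx f v (e / 4) e4.
exists n, n', b; split => //; first by rewrite n0n.
  by move=> i im; apply: bv; exact: Tv.
have h1 : nrm (lc f (u n - u n') - lc f v) <= e / 4.
  apply: le_trans (hv f) _.
  apply: (@le_trans _ _ (\sum_(i < m) e / 4 / F * nrm (f i))).
    apply: ler_sum => i _; rewrite ler_wpM2r ?nrm_ge0 // coefB ltW //.
    exact: hS.
  rewrite -mulr_sumr -[_ / F * _]mulrA ler_piMr ?ltW // mulrC ltr_pdivrMr // mul1r.
  by rewrite /F ltrDr.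
have h2 := nrm_tri (lc f v) (lc f (u n - u n')) (lc f b).
have h3 := nrm_tri (lc f (u n - u n')) (y n - y n') (lc f b).
have h4 : nrm (y n - y n' - lc f (u n - u n')) <= nrm (y n - lc f (u n)) + nrm (y n' - lc f (u n')).
  apply: le_trans (nrmB _ _); rewrite linearB /=.
  by rewrite !opprD !opprK addrACA.
have := yu n; have := yu n'; lra.
Qed.

Lemma spreading_bounded c y : 0 <= c -> spreading c y ->
  forall n, nrm (y n) <= c * nrm (y 0%N).
Proof.
move=> c0 sy n; have [|_] := sy (addn n) _ 'X^0; first by move=> i j; rewrite ltn_add2l.
by rewrite !lcX /= addn0.
Qed.

(* Differences of far apart terms are almost supported on a tail, because the
   coordinates of the terms have cluster points. *)
Lemma spreading_block_perturbation Mf f c M y : 0 <= c -> coef_bound Mf f ->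
  spreading c y -> coef_bound (fun=> M) y ->
  (forall n (e : R), 0 < e -> exists q, nrm (y n - lc f q) < e) ->
  exists d b,
    [/\ forall k, exists m n, d k = y m - y n,
        forall k, Dpoly iota (b k) /\ tail k (b k),
        equiv 2 d (lc f \o b),
        spreading (c * c) d & coef_bound (fun=> M * c) d].
Proof.
move=> c0 Mff sy My yf.
have M0 : 0 < M := coef_bound_gt0 0 My.
(* Chosen so that [M * c * ep k <= 2^-1 ^+ k.+2], where [M * c] will bound the coefficients along
   [d]; adding 1 avoids division by zero. *)
pose ep k : R := 2^-1 ^+ k.+2 / (1 + M * c).
have Mc0 : 0 <= M * c by rewrite mulr_ge0 // ltW.
have Mc1 : 0 < 1 + M * c by rewrite ltr_wpDr.
have ep0 k : 0 < ep k by rewrite divr_gt0 // exprn_gt0 // invr_gt0.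
have step := @tail_difference Mf f y (c * nrm (y 0%N)) Mff (spreading_bounded c0 sy) yf.
pose S := (nat * (nat * nat * {poly K}))%type.
pose ok (s : S) := [/\ (s.2.1.1 < s.2.1.2)%N, Dpoly iota s.2.2, tail s.1 s.2.2 &
   nrm (y s.2.1.1 - y s.2.1.2 - lc f s.2.2) < ep s.1].
have next k n0 : exists s : S, [/\ ok s, s.1 = k & (n0 <= s.2.1.1)%N].
  have [n [n' [b [/andP[n0n nn'] Db Tb hb]]]] := step k n0 (ep k) (ep0 k).
  by exists (k, (n, n', b)).
have [s0 [oks0 s00 _]] := next 0%N 0%N.
have [g [g0 gS]] := @dependent_choice {s : S | ok s}
  (fun s t => (sval t).1 = (sval s).1.+1 /\ ((sval s).2.1.2 < (sval t).2.1.1)%N)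
  (exist _ s0 oks0)
  (fun s => ltac:(
    have [t [okt tk tn]] := next (sval s).1.+1 (sval s).2.1.2.+1;
    exists (exist _ t okt); by [])).
have g1 k : (sval (g k)).1 = k.
  by elim: k => [|k IH]; [rewrite g0|have [-> _] := gS k; rewrite IH].
pose n1 k := (sval (g k)).2.1.1; pose n2 k := (sval (g k)).2.1.2.
pose b k := (sval (g k)).2.2.
have n12 k : (n1 k < n2 k)%N by rewrite /n1 /n2; case: (g k) => s [].
have n21 k : (n2 k < n1 k.+1)%N by case: (gS k).
(* [s] lists [n1 0, n2 0, n1 1, n2 1, ...] in increasing order, so [d] consists of differences over
   consecutive pairs of the subsequence [y \o s]. *)
pose s i := if odd i then n2 i./2 else n1 i./2.
have sS i : (s i < s i.+1)%N.
  by rewrite /s /= uphalf_half; case: (odd i); rewrite /= ?add1n ?add0n.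
have sP : {homo s : m n / (m < n)%N}.
  move=> m n /subnK <-; elim: (n - m.+1)%N => [//|j IH].
  by rewrite addSn; apply: ltn_trans IH (sS _).
pose P k : {poly K} := 'X^(k.*2) - 'X^(k.*2.+1).
have lcP z k : lc z (P k) = z k.*2 - z k.*2.+1 by rewrite linearB /= !lcX.
pose d k := y (n1 k) - y (n2 k).
have dE : d = lc (y \o s) \o P.
  apply/funext => k /=; rewrite lcP /= /s /= odd_double /= uphalf_half odd_double add0n.
  by rewrite doubleK.
have syS : equiv c y (y \o s) by exact: sy.
have Md : coef_bound (fun=> M * c) d.
  (* The k-th coefficient along [d] is the one of index [k.*2] along [y \o s]; passing from [y] to
     [y \o s] costs the factor [c]. *)
  move=> q k; have -> : q`_k = (lc P q)`_(k.*2).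
    rewrite coef_lc; have [qk|kq] := leqP (size q) k.
      rewrite nth_default // big1 // => i _; rewrite coefB !coefXn.
      have := leq_trans (ltn_ord i) qk => ik.
      have -> : (k.*2 == i.*2) = false by apply/eqP; lia.
      have -> : (k.*2 == i.*2.+1) = false by apply/eqP; lia.
      by rewrite subrr mulr0.
    rewrite (bigD1 (Ordinal kq)) //= big1 => [|i].
      rewrite coefB !coefXn eqxx (_ : (_ == _) = false) ?subr0 ?mulr1 ?addr0 //.
      by apply/eqP; lia.
    rewrite -val_eqE /= coefB !coefXn => /eqP ik.
    have -> : (k.*2 == i.*2) = false by apply/eqP; lia.
    have -> : (k.*2 == i.*2.+1) = false by apply/eqP; lia.
    by rewrite subrr mulr0.
  apply: le_trans (My _ _) _; rewrite -mulrA; apply: ler_wpM2l; first exact: ltW.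
  by rewrite dE -lc_lc; have [] := syS (lc P q).
exists d, b; split => //.
- by move=> k; exists (n1 k), (n2 k).
- move=> k; rewrite /b; case: (g k) (g1 k) => t [_ Dt Tt _] /= kE.
  by split => //; rewrite -kE.
- apply: (equiv_perturb Md) => k.
  have h : nrm (d k - lc f (b k)) < ep k.
    by rewrite /d /b /n1 /n2; case: (g k) (g1 k) => t [_ _ _ ht] /= kE; rewrite -kE.
  apply: (@le_trans _ _ (M * c * ep k)); first by rewrite ler_wpM2l // ltW.
  rewrite /ep mulrCA ler_piMr ?exprn_ge0 ?invr_ge0 // ler_pdivrMr // mul1r.
  by rewrite lerDr.
- move=> phi phiP.
  (* [phi2] moves pairs as [phi] moves their indices; comparing both subsequences with [y] costs [c]
     twice. *)
  pose phi2 i := ((phi i./2).*2 + odd i)%N.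
  have -> : d \o phi = lc (y \o (s \o phi2)) \o P.
    rewrite dE; apply/funext => k /=; rewrite !lcP /= /phi2 /= odd_double.
    by rewrite uphalf_half odd_double add0n doubleK addn0 addn1.
  rewrite dE; apply: equiv_lc; apply: (equiv_trans c0 c0 (equiv_sym syS)).
  apply: sy => m n mn; apply: sP; rewrite /phi2.
  have [e|ne] := eqVneq m./2 n./2.
    rewrite e ltn_add2l; move: mn; rewrite -[m]odd_double_half -[n]odd_double_half e.
    by rewrite !odd_double_half; lia.
  have /phiP : (m./2 < n./2)%N by rewrite ltn_neqAle ne half_leq // ltnW.
  by case: (odd m); case: (odd n); lia.
Qed.

(** * Closed spans *)

Lemma pos_rho (e : K) : 0 < e -> exists2 r : R, 0 < r & rho r = e.
Proof.
move=> e0; exists (re e); last by rewrite reK // gtr0_real.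
by rewrite -rho_lt rmorph0 reK // gtr0_real.
Qed.

Lemma nrm_ltE {W : normedZmodType K} (v : W) (r : R) : (`|v| < rho r) = (nrm v < r).
Proof. by rewrite -nrmE rho_lt. Qed.

Lemma closure_nrmP (A : set E) v :
  closure A v <-> forall e : R, 0 < e -> exists2 u, A u & nrm (v - u) < e.
Proof.
split=> [Av e e0|h B /nbhs_ballP[e /= /pos_rho[r r0 <-] hB]].
  have [|u [Au]] := Av (ball v (rho e)).
    by apply: nbhsx_ballx; rewrite -(rmorph0 rho) rho_lt.
  by rewrite -ball_normE /= nrm_ltE => h; exists u.
have [u Au hu] := h r r0; exists u; split => //; apply: hB.
by rewrite -ball_normE /= nrm_ltE.
Qed.

Lemma nrm_complete (s : nat -> E) :
  (forall e : R, 0 < e -> exists n0, forall n, (n0 <= n)%N -> nrm (s n0 - s n) < e) ->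
  exists t, forall e : R, 0 < e -> exists n0, forall n, (n0 <= n)%N -> nrm (t - s n) < e.
Proof.
move=> h; have /cauchy_cvgP cs : cauchy (s @ \oo).
  apply: cauchy_exP => _ /= /pos_rho[e e0 <-]; have [n0 hn] := h e e0.
  by exists (s n0); exists n0 => // n /= /hn; rewrite -ball_normE /= nrm_ltE.
exists (lim (s @ \oo)) => e e0; have /cvgrPdist_lt/(_ (rho e)) := cs.
rewrite -[X in X < _](rmorph0 rho) rho_lt => /(_ e0)[n0 _ hn].
by exists n0 => n /hn /=; rewrite nrm_ltE.
Qed.

Lemma lspan_rangeP x v : lspan (range x) v <-> exists q, v = lc x q.
Proof.
split=> [[n [u [a [xu ->]]]]|[q ->]]; last first.
  by exists (size q), (fun i => x i), (fun i => q`_i); split => // i; exists i.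
have /choice[k xk] : forall i, exists k, x k = u i.
  by move=> i; have [k _ ku] := xu i; exists k.
exists (\sum_(i < n) a i *: 'X^(k i)); rewrite linear_sum.
by apply: eq_bigr => i _; rewrite linearZ /= lcX xk.
Qed.

Lemma closed_span_rangeP x v :
  closed_span (range x) v <-> forall e : R, 0 < e -> exists q, nrm (v - lc x q) < e.
Proof.
split=> [/closure_nrmP h e /h[_ /lspan_rangeP[q ->] hq]|h].
  by exists q.
apply/closure_nrmP => e /h[q hq]; exists (lc x q) => //.
by apply/lspan_rangeP; exists q.
Qed.

Lemma lc_closed_span x q : closed_span (range x) (lc x q).
Proof.
by apply/closed_span_rangeP => e e0; exists q; rewrite subrr nrm0.
Qed.

Lemma closed_span_linear x (a : K) u v : closed_span (range x) u ->
  closed_span (range x) v -> closed_span (range x) (a *: u + v).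
Proof.
move=> /closed_span_rangeP hu /closed_span_rangeP hv; apply/closed_span_rangeP => e e0.
have a0 : 0 < 1 + nrm a by rewrite ltr_pwDl // nrm_ge0.
have [|p hp] := hu (e / 2 / (1 + nrm a)); first by rewrite !divr_gt0.
have [|q hq] := hv (e / 2); first by rewrite divr_gt0.
exists (a *: p + q); rewrite lc_linear opprD addrACA -scalerBr.
apply: le_lt_trans (nrmD _ _) _; rewrite (splitr e) nrmZ; apply: ler_ltD => //.
rewrite -(divfK (lt0r_neq0 a0) (e / 2)) mulrC.
by apply: ler_pM; rewrite ?nrm_ge0 ?(ltW hp) // lerDr.
Qed.

Lemma closed_span_closed_subspace x : closed_subspace (closed_span (range x)).
Proof.
split; last exact: closed_closure.
split; first by rewrite inE -(linear0 (lc x)); exact: lc_closed_span.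
by move=> a u v; rewrite !inE => hu hv; exact: closed_span_linear.
Qed.

Section ClosedSubspace.
Context (F : set E) (cF : closed_subspace F).

Lemma closed_subspace_linear (a : K) u v : F u -> F v -> F (a *: u + v).
Proof.
by move=> Fu Fv; have := cF.1.2 a u v; rewrite !inE; exact.
Qed.

Lemma closed_subspace_lc x q : (forall k, F (x k)) -> F (lc x q).
Proof.
move=> Fx; rewrite /lc; elim/big_rec: _ => [|i v _ Fv].
  by have := cF.1.1; rewrite inE.
exact: closed_subspace_linear.
Qed.

Lemma closed_span_sub x : (forall k, F (x k)) -> closed_span (range x) `<=` F.
Proof.
move=> Fx; rewrite [X in _ `<=` X](closure_id F).1; last exact: cF.2.
by apply: closure_subset => _ /lspan_rangeP[q ->]; exact: closed_subspace_lc.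
Qed.

End ClosedSubspace.

(** Otherwise [m.+1] terms lie in the span of [m] vectors, and a nonzero kernel vector of the
    coordinate matrix gives a vanishing combination with a nonzero coefficient. *)
Lemma coef_bound_infinite_dimensional M x F : coef_bound M x ->
  (forall k, F (x k)) -> infinite_dimensional F.
Proof.
move=> Mx Fx [s Fs]; pose m := size s.
have /choice[A xA] : forall i : 'I_m.+1, exists A : 'rV[K]_m,
    x i = \sum_(j < m) A 0 j *: s`_j.
  move=> i; have [n [u [a [su ->]]]] := Fs _ (Fx i).
  have us k : u k \in s by have := su k.
  exists (\row_j \sum_(k < n | index (u k) s == j) a k).
  under [RHS]eq_bigr => j _ do rewrite mxE scaler_suml.
  rewrite (exchange_big_dep predT) //=; apply: eq_bigr => k _.
  have uk : (index (u k) s < m)%N by rewrite index_mem.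
  rewrite (big_pred1 (Ordinal uk)) /= ?nth_index //.
pose B := \matrix_(i < m.+1) A i.
have /rowV0Pn[u /sub_kermxP uB u0] : kermx B != 0.
  by rewrite kermx_eq0 -row_leq_rank -ltnNge; exact: leq_ltn_trans (rank_leq_col _) _.
have [k uk] : exists k, u 0 k != 0.
  by apply/existsP; move: u0; apply: contraNT => /existsPn h;
     apply/eqP/rowP => k; rewrite mxE; have := h k; rewrite negbK => /eqP.
pose q : {poly K} := \poly_(i < m.+1) (u 0 (inord i)).
have q0 : lc x q = 0.
  rewrite lc_poly.
  under eq_bigr => i _ do rewrite inord_val xA scaler_sumr.
  rewrite exchange_big /= big1 // => j _.
  under eq_bigr => i _ do rewrite scalerA.
  rewrite -scaler_suml.
  have := congr1 (fun M : 'rV_m => M 0 j) uB; rewrite !mxE => h.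
  rewrite (eq_bigr (fun i => u 0 i * B i j)) ?h ?scale0r // => i _.
  by rewrite !mxE.
have := Mx q k; rewrite q0 nrm0 mulr0 coef_poly ltn_ord inord_val leNgt.
by rewrite nrm_gt0 uk.
Qed.

(** * Isomorphisms induced by equivalent sequences *)

Section Isomorphism.
Context (C : R) (x y : nat -> E) (C0 : 0 <= C) (xy : equiv C x y).

(* The closure of the graph of [lc x q |-> lc y q]. *)
Definition span_graph (x y : nat -> E) (u t : E) : Prop := forall e : R, 0 < e ->
  exists q, nrm (u - lc x q) < e /\ nrm (t - lc y q) < e.

(** The bound of [equiv] passes to limits. For [u = u'] it makes the closed graph single-valued; in
    general it gives continuity. *)
Lemma span_graph_lipschitz u u' t t' : span_graph x y u t -> span_graph x y u' t' ->
  nrm (t - t') <= C * nrm (u - u').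
Proof.
move=> h h'; apply/ler_addgt0Pr => e e0.
(* With [d] this quotient, the approximation errors add up to [2 * d + C * (2 * d) = e]. *)
have d0 : 0 < e / (2 + 2 * C) by rewrite divr_gt0 // ltr_pwDl // mulr_ge0.
have [q [uq tq]] := h _ d0; have [q' [uq' tq']] := h' _ d0.
set d := e / _ in d0 uq tq uq' tq'.
have -> : e = 2 * d + C * (2 * d).
  have C2 : 2 + 2 * C != 0 by rewrite gt_eqF // ltr_pwDl // mulr_ge0.
  by rewrite -{1}(divfK C2 e) -/d; lra.
have h1 : nrm (t - t') <= nrm (t - lc y q) + nrm (lc y (q - q')) + nrm (t' - lc y q').
  apply: le_trans (nrm_tri (lc y q) _ _) _; rewrite -addrA lerD2l linearB /=.
  by apply: le_trans (nrm_tri (lc y q') _ _) _; rewrite lerD2l (nrmBC t').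
have h2 : nrm (lc x (q - q')) <= nrm (u - u') + nrm (u - lc x q) + nrm (u' - lc x q').
  rewrite linearB /=; apply: le_trans (nrm_tri u _ _) _.
  rewrite (nrmBC _ u) addrC addrAC lerD2r.
  exact: le_trans (nrm_tri u' _ _) _.
have [_ h3] := xy (q - q').
have h4 : C * nrm (lc x (q - q')) <= C * (nrm (u - u') + 2 * d).
  by apply: ler_wpM2l => //; lra.
lra.
Qed.

(** The images of an approximating sequence are Cauchy by [equiv], and [E] is complete. *)
Lemma span_graph_exists u : closed_span (range x) u -> exists t, span_graph x y u t.
Proof.
move=> /closed_span_rangeP hu.
have /choice[q uq] : forall n : nat, exists q, nrm (u - lc x q) < n.+1%:R^-1.
  by move=> n; apply: hu; rewrite invr_gt0 ltr0n.
have arch (e : R) : 0 < e -> exists n0 : nat, forall n, (n0 <= n)%N -> n.+1%:R^-1 < e.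
  move=> e0; have [n0 _ hn] := near_infty_natSinv_lt (interval_inference.PosNum e0).
  by exists n0 => n /hn.
have [|t ht] := @nrm_complete (fun n => lc y (q n)).
  move=> e e0; have [|n0 hn] := arch (e / (2 * (C + 1))).
    by rewrite divr_gt0 // mulr_gt0 // ltr_wpDl.
  exists n0 => n n0n; rewrite -linearB /=; have [_ h] := xy (q n0 - q n).
  have := nrm_tri u (lc x (q n0)) (lc x (q n)); rewrite (nrmBC _ u) -linearB /= => h1.
  have h2 := lt_trans (uq n) (hn n n0n); have h3 := lt_trans (uq n0) (hn n0 (leqnn _)).
  apply: le_lt_trans h _; apply: le_lt_trans (ler_wpM2l C0 h1) _.
  set d := e / _ in h2 h3.
  have -> : e = 2 * (C + 1) * d.
    by rewrite /d mulrC divfK // mulf_neq0 // gt_eqF // ltr_wpDl.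
  have d0 : 0 < d by rewrite (le_lt_trans (nrm_ge0 _) h2).
  have h4 : C * (nrm (u - lc x (q n0)) + nrm (u - lc x (q n))) <= C * (2 * d).
    by apply: ler_wpM2l => //; lra.
  lra.
exists t => e e0; have [n0 h0] := arch e e0; have [n1 h1] := ht e e0.
exists (q (maxn n0 n1)); split; last by apply: h1; exact: leq_maxr.
by apply: lt_trans (uq _) _; apply: h0; exact: leq_maxl.
Qed.

Lemma span_graph_linear (a : K) u u' t t' : span_graph x y u t ->
  span_graph x y u' t' -> span_graph x y (a *: u + u') (a *: t + t').
Proof.
move=> h h' e e0.
have a0 : 0 < 1 + nrm a by rewrite ltr_pwDl // nrm_ge0.
have [|p [up tp]] := h (e / 2 / (1 + nrm a)); first by rewrite !divr_gt0.
have [|q [uq tq]] := h' (e / 2); first by rewrite divr_gt0.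
have aux (v v' w w' : E) : nrm (v - w) < e / 2 / (1 + nrm a) -> nrm (v' - w') < e / 2 ->
    nrm (a *: v + v' - (a *: w + w')) < e.
  move=> vw vw'; rewrite opprD addrACA -scalerBr.
  apply: le_lt_trans (nrmD _ _) _; rewrite (splitr e) nrmZ; apply: ler_ltD => //.
  rewrite -(divfK (lt0r_neq0 a0) (e / 2)) mulrC.
  by apply: ler_pM; rewrite ?nrm_ge0 ?(ltW vw) // lerDr.
by exists (a *: p + q); rewrite !lc_linear; split; exact: aux.
Qed.

(** Outside the closed span of [x] the graph has no value and the default [0] is taken. *)
Definition span_map (u : E) : E := xget 0 (span_graph x y u).

Lemma span_mapP u : closed_span (range x) u -> span_graph x y u (span_map u).
Proof. by move=> /span_graph_exists; exact: xgetPex. Qed.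

Lemma span_map_eq u t : closed_span (range x) u -> span_graph x y u t -> span_map u = t.
Proof.
move=> /span_mapP h h'; have := span_graph_lipschitz h h'.
by rewrite subrr nrm0 mulr0 le_eqVlt ltNge nrm_ge0 orbF nrm_eq0 subr_eq0 => /eqP.
Qed.

Lemma span_map_continuous : {within closed_span (range x), continuous span_map}.
Proof.
apply/subspace_continuousP => u Fu; apply/cvgrPdist_lt => _ /pos_rho[e e0 <-].
have C1 : 0 < C + 1 by rewrite ltr_wpDl.
near=> v.
have Fv : closed_span (range x) v by near: v; exact: withinT.
have huv : nrm (u - v) < e / (C + 1).
  rewrite -nrm_ltE; near: v; apply: cvg_within; rewrite /=.
  have /cvgrPdist_lt := @cvg_id _ (nbhs u).
  by apply; rewrite -(rmorph0 rho) rho_lt divr_gt0.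
rewrite nrm_ltE.
apply: le_lt_trans (span_graph_lipschitz (span_mapP Fu) (span_mapP Fv)) _.
move: huv; rewrite ltr_pdivlMr // => huv; apply: le_lt_trans huv.
by rewrite mulrC ler_wpM2l ?nrm_ge0 // lerDl.
Unshelve. all: by end_near.
Qed.

End Isomorphism.

Lemma span_graph_sym x y u t : span_graph x y u t -> span_graph y x t u.
Proof. by move=> h e /h[q [? ?]]; exists q. Qed.

Lemma span_graph_codom x y u t : span_graph x y u t -> closed_span (range y) t.
Proof. by move=> h; apply/closed_span_rangeP => e /h[q [_ ?]]; exists q. Qed.

(** Exchanging the sequences reverses the graph, so the map built from [y] to [x] is the inverse. *)
Lemma equiv_isomorphic C x y : 0 <= C -> equiv C x y ->
  isomorphic_subspaces (closed_span (range x)) (closed_span (range y)).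
Proof.
move=> C0 xy; have yx := equiv_sym xy.
have fP u := @span_mapP C x y C0 xy u.
have gP u := @span_mapP C y x C0 yx u.
have fg u : closed_span (range x) u -> span_map y x (span_map x y u) = u.
  move=> Fu; apply: (span_map_eq C0 yx); last exact: span_graph_sym (fP _ Fu).
  exact: span_graph_codom (fP _ Fu).
have gf u : closed_span (range y) u -> span_map x y (span_map y x u) = u.
  move=> Fu; apply: (span_map_eq C0 xy); last exact: span_graph_sym (gP _ Fu).
  exact: span_graph_codom (gP _ Fu).
exists (span_map x y), (span_map y x); split.
- move=> u v; rewrite !inE => Fu Fv a.
  apply: (span_map_eq C0 xy); first exact: closed_span_linear.
  exact: span_graph_linear (fP _ Fu) (fP _ Fv).
- split.
  + by move=> u Fu; exact: span_graph_codom (fP _ Fu).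
  + by move=> u v; rewrite !inE => Fu Fv e; rewrite -(fg u) // e fg.
  + move=> t Ft; exists (span_map y x t); last exact: gf.
    exact: span_graph_codom (gP _ Ft).
- by move=> u; rewrite inE; exact: fg.
- exact: span_map_continuous C0 xy.
- exact: span_map_continuous C0 yx.
Qed.

Lemma saturated_spreading G : saturated_with_subsymmetric [set: E] ->
  closed_subspace G -> infinite_dimensional G ->
  exists c y, [/\ 0 <= c, forall k, G (y k), spreading c y & y 0%N != y 1%N].
Proof.
move=> sat cG iG; have [//|y [yG [c [c1 [[by_ _] ce]]]]] := sat G cG iG.
have [r r1 rc] : exists2 r : R, 0 < r & rho r = c.
  by apply: pos_rho; exact: lt_le_trans c1.
exists r, y; split; first exact: ltW.
- by move=> k; apply: yG; exists k.
- move=> phi phiP q.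
  have [|T [Ty hT]] := ce phi; first exact: leq_mono.
  have Tq : T (lc y q) = lc (y \o phi) q by rewrite -[q]coefK !lc_poly Ty.
  have /hT : lspan (range y) (lc y q) by apply/lspan_rangeP; exists q.
  rewrite Tq -!nrmE -rc -fmorphV -!rmorphM !rho_le => /andP[h1 h2]; split => //.
  by move: h1; rewrite mulrC ler_pdivrMr // mulrC.
(* If the two terms agreed, [y 0] would have two expansions, with the single coefficient 1 at index
   0 or at index 1. *)
- apply/eqP => y01.
  have [|a [_ au]] := by_ (y 0%N).
    by rewrite -(lcX y 0); exact: lc_closed_span.
  have cv k : y k = y 0%N -> (k < 2)%N ->
      series (fun n => ((n == k)%:R : K) *: y n) @ \oo --> y 0%N.
    move=> yk k2; apply: cvg_near_cst; exists 2%N => // n /= n2.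
    rewrite seriesEord /= (bigD1 (Ordinal (leq_trans k2 n2))) //= eqxx scale1r big1 ?addr0 //.
    by move=> i; rewrite -val_eqE /= => /negPf ->; rewrite scale0r.
  have := au _ (cv 0%N erefl isT); rewrite (au _ (cv 1%N (esym y01) isT)).
  move=> /(congr1 (fun f => f 0%N)) /= /esym /eqP.
  by rewrite oner_eq0.
Qed.

(** * Existence of a minimal subspace *)

(** A spreading sequence in [G] is replaced by differences of its terms, which remain in [G] and are
    close to tail vectors along [f]. *)
Lemma saturated_perturbation Mf f G : saturated_with_subsymmetric [set: E] ->
  coef_bound Mf f -> closed_subspace G -> infinite_dimensional G ->
  G `<=` closed_span (range f) ->
  exists c M d b,
    [/\ 0 <= c, forall k, G (d k),
        forall k, Dpoly iota (b k) /\ tail k (b k),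
        equiv 2 d (lc f \o b) &
        spreading c d /\ coef_bound (fun=> M) d].
Proof.
move=> sat Mff cG iG Gf.
have [c [y [c0 Gy sy y01]]] := saturated_spreading sat cG iG.
have My := spreading_coef_bound c0 sy y01.
have [|d [b [dy Db eb sd Md]]] := spreading_block_perturbation c0 Mff sy My.
  by move=> n; apply/closed_span_rangeP; exact: Gf.
exists (c * c), (2 * c ^+ 2 / nrm (y 0%N - y 1%N) * c), d, b; split => //.
  exact: mulr_ge0.
move=> k; have [m [n ->]] := dy k.
rewrite addrC -scaleN1r; exact: closed_subspace_linear.
Qed.

(** * The game on formal vectors along a fixed sequence *)

Section Basis.
Context (e : nat -> E) (Me : nat -> R) (eM : coef_bound Me e).
Hypothesis sat : saturated_with_subsymmetric [set: E].

Notation V := {poly K}.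
Notation bigD := (big iota).

Lemma block_coef_bound (F : nat -> V) : block F ->
  coef_bound (fun k => Me (size (F k)).-1 / nrm (lead_coef (F k))) (lc e \o F).
Proof.
move=> bF q k; have l0 : 0 < nrm (lead_coef (F k)).
  by rewrite nrm_gt0 lead_coef_eq0; exact: bF.1.
rewrite mulrAC ler_pdivlMr // -nrmM -block_coef // -lc_lc; exact: eM.
Qed.

(** A block sequence in [X] inherits coefficient bounds, so saturation applies to its closed span;
    the formal approximants obtained there are combinations of blocks over [D], hence in [X]. *)
Lemma big_spreading X : bigD X -> exists c M (g : nat -> V),
  [/\ 0 <= c, forall k, X (g k), forall k, tail k (g k),
      spreading c (lc e \o g) & coef_bound (fun=> M) (lc e \o g)].
Proof.
move=> bX; have [F [bF XF]] := big_block (fun=> bX).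
have Mf := block_coef_bound bF.
have [|c [M [d [b [c0 _ Db eb [sd Md]]]]]] :=
    saturated_perturbation sat Mf (closed_span_closed_subspace _) _ (@subset_refl _ _).
  apply: (coef_bound_infinite_dimensional Mf) => k.
  by rewrite -(lcX (lc e \o F) k); exact: lc_closed_span.
have egE : lc e \o (lc F \o b) = lc (lc e \o F) \o b.
  by apply/funext => k /=; rewrite lc_lc.
exists (2 * c * 2), (M * 2), (lc F \o b); rewrite egE; split.
- by rewrite !mulr_ge0.
- move=> k; have [DX subX _] := bX.
  by apply: (Dsubmod_lc subX); [case: (Db k)|move=> i _; exact: XF].
- move=> k; have [_ Tb] := Db k; apply: (tail_lc Tb) => i ki.
  by apply: (tail_decr ki); exact: block_tail.
- exact: spreading_equiv eb sd.
- exact: coef_bound_equiv eb Md.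
Qed.

(* The even entries of a position are the [w_i], the odd ones the [z_i]. *)
Definition pos_equiv (C : R) (p : seq V) : Prop :=
  forall a : V, (size a <= (size p)./2)%N ->
    nrm (lc (fun i => lc e p`_i.*2) a) <= C * nrm (lc (fun i => lc e p`_i.*2.+1) a) /\
    nrm (lc (fun i => lc e p`_i.*2.+1) a) <= C * nrm (lc (fun i => lc e p`_i.*2) a).

Notation goodC C := (good tail bigD (fun p => ~ pos_equiv C p)).

Definition shift (s : nat -> nat) : V -> V := lc (fun j => 'X^(s j)).

(* The answers of the second player are shifts of the vectors played by the
   first one, along a map that is extended as the game proceeds. *)
Definition shifted_position (g : nat -> V) (p : seq V) : Prop :=
  exists (s : nat -> nat) (N : nat) (Q : nat -> V),
    [/\ {homo s : m n / (m < n)%N},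
        forall i, (i.*2 < size p)%N -> p`_i.*2 = lc g (Q i),
        forall i, (i.*2.+1 < size p)%N ->
          p`_i.*2.+1 = lc g (shift s (Q i)) /\ (size (Q i) <= N)%N &
        odd (size p) -> tail N (Q (size p)./2) /\ Dpoly iota (Q (size p)./2)].

(** By induction over [good], no good position is a shifted one. [Q i] holds the coordinates of
    [w_i] along [g]; the answered ones have size at most [N], so the shift can be redefined from [N]
    on without changing past answers. *)
Lemma good_everywhere_absurd X : bigD X -> (forall n : nat, goodC n%:R X [::]) -> False.
Proof.
move=> bX gX; have [c [M [g [c0 Xg Tg sg Mg]]]] := big_spreading bX.
have [DX subX _] := bX.
have g0 k : g k != 0.
  apply/eqP => gk; have := Mg 'X^k k.
  by rewrite coefXn eqxx nrm1 lcX /= gk linear0 nrm0 mulr0 ler10.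
have [n cn] : exists n : nat, c <= n%:R.
  by exists (Num.truncn c).+1; rewrite ltW // truncnS_gt.
suff /(_ [::]) : forall p, goodC n%:R X p -> ~ shifted_position g p.
  move=> h; apply: (h (gX n)); exists id, 0%N, (fun=> 0); by split.
move=> p gp; have /= := gp [set q : seq V | ~ shifted_position g q]; apply => {gp}p.
(* The two sides are the same combinations along [lc e \o g] and along its subsequence given by [s],
   hence equivalent with constant [c]. *)
- move=> nO [s [N [Q [sP Qe Qo _]]]]; apply: nO => a ap.
  have i2 i : (i < size a)%N -> (i.*2.+1 < size p)%N.
    by move=> ia; have := leq_trans ia ap; have := odd_double_half (size p); lia.
  have -> : lc (fun i => lc e p`_i.*2) a = lc (lc e \o g) (lc Q a).
    by rewrite lc_lc; apply: eq_lc => i /i2 ia; rewrite Qe ?lc_lc // ltnW.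
  have -> : lc (fun i => lc e p`_i.*2.+1) a = lc ((lc e \o g) \o s) (lc Q a).
    rewrite lc_lc; apply: eq_lc => i /i2 ia.
    by rewrite (Qo _ ia).1 lc_comp lc_lc.
  exact: (equiv_le cn (sg s sP)).
- move=> ep h [s [N [Q [sP Qe Qo _]]]].
  (* The opponent offers the span of [g] from [N] on, so that the new coordinates start where [s] is
     still free. *)
  have [||w [[r Dr <-]]] := h (Dspan iota (fun j => g (N + j)%N)).
  + apply: big_Dspan => [i|m]; first exact: DX.
    by exists m; split => //; apply: tail_decr (Tg _); exact: leq_addl.
  + by apply: Dspan_sub => // i; exact: Xg.
  apply; pose Q0 := shift (addn N) r.
  have gQ0 : lc (fun j => g (N + j)%N) r = lc g Q0.
    by rewrite /Q0 /shift -(lc_comp g).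
  exists s, N, (fun i => if i == (size p)./2 then Q0 else Q i); rewrite gQ0 size_rcons; split => //.
  + move=> i; rewrite ltnS nth_rcons leq_eqVlt => /orP[/eqP ip|ip].
      by rewrite -ip ltnn eqxx doubleK eqxx.
    rewrite ip Qe //; case: eqP => // ie.
    by move: ip; rewrite ie even_halfK // ltnn.
  + move=> i; rewrite ltnS => ip; rewrite nth_rcons.
    have {}ip : (i.*2.+1 < size p)%N.
      rewrite ltn_neqAle ip andbT; apply: contra ep => /eqP <- /=.
      by rewrite odd_double.
    rewrite ip; case: eqP => [ie|_]; last exact: Qo.
    by move: ip; rewrite ie even_halfK // ltnNge leqnSn.
  + move=> _; rewrite /= uphalf_half (negbTE ep) add0n eqxx; split.
      apply: (@tail_lc _ 0%N) => // i _; apply: tailXn; exact: leq_addr.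
    by apply: Dsubmod_lc (Dsubmod_Dpoly iota) Dr _ => i _; exact: Dpoly_Xn.
- move=> op [n0 h] [s [N [Q [sP Qe Qo /(_ op)[TQ DQ]]]]].
  set k := (size p)./2 in TQ DQ.
  have pk : size p = k.*2.+1 by rewrite -[LHS]odd_double_half op.
  (* From [N] on, the map jumps past [n0], which puts the answer into the tail just named, and past
     [s N], which keeps it increasing. *)
  pose s' j := if (j < N)%N then s j else (s N + n0 + j)%N.
  have s'P : {homo s' : i j / (i < j)%N}.
    move=> i j ij; rewrite /s'; have [jN|Nj] := ltnP j N.
      by rewrite (ltn_trans ij jN); exact: sP.
    have [/sP iN|Ni] := ltnP i N; last by rewrite ltn_add2l.
    by lia.
  have shE q : (size q <= N)%N -> shift s' q = shift s q.
    by move=> qN; apply: eq_lc => i iq; rewrite /s' (leq_trans iq qN).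
  apply: (h (lc g (shift s' (Q k)))).
    rewrite -(lc_comp g); split; first by apply: (Dsubmod_lc subX DQ) => i _; exact: Xg.
    apply: (tail_lc TQ) => i Ni; apply: tail_decr (Tg _).
    by rewrite /s' ltnNge Ni /=; lia.
  exists s', (maxn N (size (Q k))), Q; rewrite size_rcons; split => //.
  + move=> i ip; rewrite nth_rcons.
    have {}ip : (i.*2 < size p)%N by move: ip; rewrite pk; lia.
    by rewrite ip Qe.
  + move=> i; rewrite ltnS leq_eqVlt nth_rcons => /orP[ip|ip].
      have ik : i = k by move: ip; rewrite pk; lia.
      by rewrite ik -pk ltnn eqxx leq_maxr.
    have [-> QN] := Qo i ip.
    by rewrite ip shE // (leq_trans QN) // leq_maxl.
  + by rewrite /= op.
Qed.

(** The play stays in [B]: the [w_i] are far out terms of [g], the [z_i] formal copies of vectors of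
    [G]. No position in [B] is open, so the two sequences are [C]-equivalent. *)
Lemma bad_minimal C Y0 : 0 <= C -> bigD Y0 ->
  (forall Z, bigD Z -> Z `<=` Y0 -> ~ goodC C Z [::]) ->
  exists F : set E, [/\ closed_subspace F, infinite_dimensional F & minimal_space F].
Proof.
move=> C0 bY0 /(game_dichotomy (@tail_decr K) (@big_subset _ _ iota) (@big_tail _ _ iota)
  (@big_diag _ _ iota) (@DpositionsP _ _ iota) bY0).
move=> [X [B [[bX _ B0] [BO Be Bo]]]].
have [c [M [g [c0 Xg Tg sg Mg]]]] := big_spreading bX.
have [DX subX _] := bX.
set x := lc e \o g in sg Mg.
have xF k : closed_span (range x) (x k).
  by rewrite -(lcX x k); exact: lc_closed_span.
exists (closed_span (range x)); split.
- exact: closed_span_closed_subspace.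
- exact: coef_bound_infinite_dimensional Mg xF.
move=> G cG iG GF.
have [c' [M' [d [b [_ Gd Db eb [_ Md]]]]]] := saturated_perturbation sat Mg cG iG GF.
have Xb k : X (lc g (b k)).
  by apply: (Dsubmod_lc subX); [case: (Db k)|move=> i _; exact: Xg].
pose Z := Dspan iota (lc g \o b).
have ZX : Z `<=` X by apply: Dspan_sub.
have bZ : bigD Z.
  apply: big_Dspan => [i|m]; first by apply: DX; exact: Xb.
  exists m; split.
    have [_ Tb] := Db m; apply: (tail_lc Tb) => i mi.
    by apply: (tail_decr mi); exact: Tg.
  (* If [lc g (b m)] vanished, so would [d m], against the coefficient bound of [d]. *)
  apply/eqP => /= gb0; have [+ _] := eb 'X^m; rewrite !lcX /= -[lc x _]lc_lc gb0.
  rewrite linear0 nrm0 mulr0 => dm; have := Md 'X^m m.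
  rewrite coefXn eqxx nrm1 lcX leNgt (le_lt_trans _ ltr01) //.
  by rewrite mulr_ge0_le0 // ltW // (coef_bound_gt0 0 Md).
(* A state holds the position, the index of the last term of [g] played and the coordinates of the
   last answer along [lc g \o b]. *)
pose ok (s : seq V * nat * V) := B s.1.1 /\ ~~ odd (size s.1.1).
have step (s : {s | ok s}) : exists t : {s | ok s},
    (sval t).1.1 = rcons (rcons (sval s).1.1 (g (sval t).1.2)) (lc (lc g \o b) (sval t).2) /\
    ((sval s).1.2 < (sval t).1.2)%N.
  case: s => -[[p m] r] [/= Bp ep]; have [n0 hn] := Be p Bp ep.
  have [||z [[r' _ <-] Bz]] := Bo (rcons p (g (maxn n0 m.+1))) _ _ Z bZ ZX.
  - by apply: hn; split => //; apply: tail_decr (Tg _); exact: leq_maxl.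
  - by rewrite size_rcons /= ep.
  unshelve eexists; first by
    exists (rcons (rcons p (g (maxn n0 m.+1))) (lc (lc g \o b) r'), maxn n0 m.+1, r');
    split => //=; rewrite !size_rcons /= negbK.
  by split => //=; exact: leq_maxr.
have ok0 : ok ([::], 0%N, 0) by [].
have [f [f0 fS]] := dependent_choice (exist _ _ ok0) step.
pose P k := (sval (f k)).1.1; pose nu k := (sval (f k.+1)).1.2.
pose r k := (sval (f k.+1)).2.
have PS k : P k.+1 = rcons (rcons (P k) (g (nu k))) (lc (lc g \o b) (r k)).
  by case: (fS k).
have sP k : size (P k) = k.*2.
  by elim: k => [|k IH]; [rewrite /P f0|rewrite PS !size_rcons IH].
have nuS k : (nu k < nu k.+1)%N by have [_] := fS k.+1.
have nuP : {homo nu : i j / (i < j)%N}.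
  move=> i j /subnK <-; elim: (j - i.+1)%N => [|k IH]; first exact: nuS.
  by rewrite addSn; apply: ltn_trans IH (nuS _).
have Pnth k i : (i < k)%N ->
    (P k)`_i.*2 = g (nu i) /\ (P k)`_i.*2.+1 = lc (lc g \o b) (r i).
  elim: k => // k IH; rewrite ltnS leq_eqVlt PS !nth_rcons !size_rcons sP.
  move=> /orP[/eqP -> |ik]; first by rewrite !ltnn !eqxx ltnSn.
  have -> : (i.*2 < k.*2.+1)%N by lia.
  have -> : (i.*2.+1 < k.*2.+1)%N by lia.
  have -> : (i.*2 < k.*2)%N by lia.
  have -> : (i.*2.+1 < k.*2)%N by lia.
  exact: IH.
have wz : equiv C (x \o nu) (lc (lc x \o b) \o r).
  (* After [size q] rounds all terms that [q] combines have been played. *)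
  move=> q; have : pos_equiv C (P (size q)).
    by apply: contrapT; apply: BO; rewrite /P; case: (f (size q)) => s [].
  move=> /(_ q); rewrite sP doubleK leqnn => /(_ isT).
  have -> : lc (fun i => lc e (P (size q))`_i.*2) q = lc (x \o nu) q.
    by apply: eq_lc => i /Pnth[-> _].
  have -> // : lc (fun i => lc e (P (size q))`_i.*2.+1) q = lc (lc (lc x \o b) \o r) q.
  by apply: eq_lc => i /Pnth[_ ->] /=; rewrite -!lc_lc.
(* The factors come from replacing formal copies by [d] (2), from the game ([C]) and from passing
   from [x \o nu] to [x] ([c]). *)
have hx : equiv (2 * C * c) (lc d \o r) x.
  apply: (equiv_trans _ c0 _ (equiv_sym (sg nu nuP))); first exact: mulr_ge0.
  by apply: (equiv_trans _ C0 (equiv_lc r eb) (equiv_sym wz)).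
exists (closed_span (range (lc d \o r))); split.
- exact: closed_span_closed_subspace.
- by apply: (closed_span_sub cG) => k; exact: (closed_subspace_lc cG).
- by apply: equiv_isomorphic hx; rewrite !mulr_ge0.
Qed.

End Basis.

Theorem saturated_minimal : infinite_dimensional [set: E] ->
  saturated_with_subsymmetric [set: E] ->
  exists F : set E, [/\ closed_subspace F, infinite_dimensional F & minimal_space F].
Proof.
move=> iE sat.
have cE : closed_subspace [set: E].
  by split; [split=> [|a u v _ _]; rewrite inE|exact: closedT].
have [c [y [c0 _ sy y01]]] := saturated_spreading sat cE iE.
have My := spreading_coef_bound c0 sy y01.
(* Integer constants suffice; being countably many, they can be handled by a single diagonal set. *)
pose gd (n : nat) := good tail (big iota) (fun p => ~ pos_equiv y n%:R p).
have [[n [Y [bY nY]]]|h] := pselect (exists n Y, big iota Y /\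
    forall Z, big iota Z -> Z `<=` Y -> ~ gd n Z [::]).
  exact: bad_minimal My sat _ _ (ler0n _ n) bY nY.
have [|X [bX _ hX]] := stabilize (@big_diag _ _ iota) (Q := fun n Z => gd n Z [::])
    (big_Dpoly iota).
  move=> n Y bY _; apply: contrapT => nZ; apply: h; exists n, Y; split => // Z bZ ZY gZ.
  by apply: nZ; exists Z.
exfalso; apply: (good_everywhere_absurd My sat bX) => n.
have [Z [m [_ gZ XZ]]] := hX n.
exact: (good_almost (@tail_decr K) (@big_tail _ _ iota) XZ gZ).
Qed.

End Norm.

(** * Real and complex scalars *)

Section Scalars.
Context {R : realType}.

(** The list is a grid of multiples of [e]; rounding down [a / e + n], nonnegative because
    [|a / e| < n], finds the grid point at or just below [a]. *)
Lemma real_balls_precompact (B e : R) : 0 < e ->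
  exists s : seq R, forall a, `|a| <= B -> exists t, t \in s /\ `|a - t| < e.
Proof.
move=> e0; pose n := (Num.truncn (B / e)).+1.
have Bn : B / e < n%:R by exact: truncnS_gt.
exists [seq (i%:R - n%:R) * e | i <- iota 0 (n + n)] => a aB.
pose x := a / e + n%:R.
have aE : a = (x - n%:R) * e by rewrite /x addrK divfK // gt_eqF.
have /andP[x0 xn] : (0 <= x) && (x < (n + n)%:R).
  have : `|a / e| < n%:R.
    rewrite normrM [X in _ * X]gtr0_norm ?invr_gt0 //; apply: le_lt_trans Bn.
    by rewrite ler_wpM2r // invr_ge0 ltW.
  by rewrite ltr_norml natrD /x => /andP[? ?]; apply/andP; split; lra.
have /andP[ix xi] := truncn_itv x0.
exists (((Num.truncn x)%:R - n%:R) * e); split.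
  apply/mapP; exists (Num.truncn x) => //; rewrite mem_iota add0n /=.
  by rewrite -(ltr_nat R); apply: le_lt_trans xn.
rewrite {1}aE -mulrBl opprB addrA subrK normrM (gtr0_norm e0) gtr_pMl //.
rewrite ger0_norm ?subr_ge0 // ltrBlDl.
by rewrite -natr1 in xi.
Qed.

Lemma rat_dense (a e : R) : 0 < e -> exists q : rat, `|a - ratr q| < e.
Proof.
move=> e0; have [|q] := @rat_in_itvoo R (a - e) (a + e); first by lra.
rewrite in_itv /= => /andP[h1 h2]; exists q; rewrite ltr_norml; lra.
Qed.

Lemma Re_norm (z : R[i]) : (complex.Re `|z|)%:C = `|z|.
Proof. by rewrite RRe_real // normr_real. Qed.

Lemma Re_le_norm (z : R[i]) : `|complex.Re z| <= complex.Re `|z|.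
Proof. by rewrite -lecR Re_norm normc_ge_Re. Qed.

Lemma norm_complexi : `|'i%C| = 1 :> R[i].
Proof. by rewrite normc_def /= expr0n add0r expr1n sqrtr1. Qed.

Lemma Im_le_norm (z : R[i]) : `|complex.Im z| <= complex.Re `|z|.
Proof.
have := Re_le_norm (z * 'i%C).
by rewrite ReiNIm normrN normrM norm_complexi mulr1.
Qed.

Lemma norm_le_ReIm (z : R[i]) :
  complex.Re `|z| <= `|complex.Re z| + `|complex.Im z|.
Proof.
have normC (x : R) : `|x%:C| = `|x|%:C.
  by rewrite normc_def /= expr0n addr0 sqrtr_sqr.
rewrite -lecR Re_norm {1}[z]complexE rmorphD /=; apply: le_trans (ler_normD _ _) _.
by rewrite normrM norm_complexi mul1r !normC.
Qed.

Lemma complex_balls_precompact (B e : R) : 0 < e ->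
  exists s : seq R[i], forall a, complex.Re `|a| <= B ->
    exists t, t \in s /\ complex.Re `|a - t| < e.
Proof.
move=> e0; have [|s hs] := @real_balls_precompact B (e / 2); first by rewrite divr_gt0.
exists [seq u +i* v | u <- s, v <- s] => a aB.
have [u [us hu]] := hs _ (le_trans (Re_le_norm a) aB).
have [v [vs hv]] := hs _ (le_trans (Im_le_norm a) aB).
exists (u +i* v); split; first by apply/allpairsP; exists (u, v).
apply: le_lt_trans (norm_le_ReIm _) _; rewrite (splitr e).
by case: a hu hv {aB} => x y /= hu hv; rewrite ltrD.
Qed.

(* Evaluation at ['i] maps [rat[X]] onto the countable dense ring [Q[i]]. *)
Definition gauss_rat : {rmorphism {poly rat} -> R[i]} :=
  horner_morph (fun x => mulrC ('i%C : R[i]) (ratr x)).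

Lemma gauss_rat_dense (a : R[i]) (e : R) : 0 < e ->
  exists q, complex.Re `|a - gauss_rat q| < e.
Proof.
move=> e0; have e2 : 0 < e / 2 by rewrite divr_gt0.
have [x hx] := rat_dense (complex.Re a) e2; have [y hy] := rat_dense (complex.Im a) e2.
exists (x%:P + 'X * y%:P).
have -> : gauss_rat (x%:P + 'X * y%:P) = ratr x +i* ratr y.
  rewrite rmorphD rmorphM /= /horner_morph !map_polyC map_polyX !hornerC hornerX /=.
  have ratC q : ratr q = (ratr q)%:C :> R[i] by exact/esym/(fmorph_rat (real_complex R)).
  by rewrite !ratC; simpc.
apply: le_lt_trans (norm_le_ReIm _) _; rewrite (splitr e).
by case: a hx hy => u v /= hx hy; rewrite ltrD.
Qed.

End Scalars.

Theorem corollary3p5 (R : realType) :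
  (forall E : completeNormedModType R,
      infinite_dimensional [set: E] ->
      saturated_with_subsymmetric [set: E] ->
      exists F : set E,
        [/\ closed_subspace F, infinite_dimensional F & minimal_space F]) /\
  (forall E : completeNormedModType R[i],
      infinite_dimensional [set: E] ->
      saturated_with_subsymmetric [set: E] ->
      exists F : set E,
        [/\ closed_subspace F, infinite_dimensional F & minimal_space F]).
Proof.
split=> E iE sat.
- apply: (@saturated_minimal R R idfun idfun _ _ E _ rat (@ratr R) _ iE sat) => //.
  + exact: real_balls_precompact.
  + exact: rat_dense.
- apply: (@saturated_minimal R R[i] (real_complex R) (@complex.Re R) _ _ E _
    {poly rat} gauss_rat _ iE sat).
  + exact: lecR.
  + exact: RRe_real.
  + exact: complex_balls_precompact.
  + exact: gauss_rat_dense.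
Qed.
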